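(* Let $R(q)$ denote the Rogers--Ramanujan continued fraction. Then $$ R^{5}\left( e^{-\pi \sqrt{48/5}} \right) = \sqrt{a^2+1}-a, $$ where $$ a = 2118 + \frac{1885 \sqrt{5}}{2} + \frac{4875 \sqrt{3}}{4} + \frac{2175 \sqrt{15}}{4}. $$
   Context: For $|q|<1$, the Rogers--Ramanujan continued fraction is $$ R(q) = \cfrac{q^{1/5}}{1 + \cfrac{q}{1 + \cfrac{q^2}{1 + \cfrac{q^3}{1+\cdots}}}} = q^{1/5}\prod_{n=1}^{\infty}\frac{(1-q^{5n-1})(1-q^{5n-4})}{(1-q^{5n-2})(1-q^{5n-3})}. $$ Here $q^{1/5}$ is the positive real fifth root for $0<q<1$, and $R^5(q)$ denotes $(R(q))^5$. *)

(* Defs.v *)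
(* Stdlib real numbers with Coquelicot limits. *)
From Stdlib Require Import Reals Lra Lia.
From Coquelicot Require Import Coquelicot.
Open Scope R_scope.

(* [RR_denom q k n] is the finite continued fraction
   1 + q^k / (1 + q^(k+1) / (1 + ... + q^(k+n-1) / 1)), with n partial
   quotients q^k, ..., q^(k+n-1). *)
Fixpoint RR_denom (q : R) (k n : nat) : R :=
  match n with
  | O => 1
  | S m => 1 + q ^ k / RR_denom q (S k) m
  end.

(* [Rpower q (1 / 5)] is the positive fifth root of q when 0 < q, so these
   convergents are meant for 0 < q < 1 only. *)
Definition RR_convergent (q : R) (n : nat) : R :=
  Rpower q (1 / 5) / RR_denom q 1 n.

(* The value of the infinite continued fraction is the limit of its
   convergents. [Lim_seq] is total; [RR_convergent_lim] shows that the limit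
   exists for 0 < q < 1. *)
Definition RogersRamanujan (q : R) : R := real (Lim_seq (RR_convergent q)).

Lemma RR_denom_ge1 (q : R) (n : nat) :
  0 < q -> forall k, 1 <= RR_denom q k n.
Proof.
  intros Hq; induction n as [|n IH]; intros k; simpl.
  - lra.
  - assert (0 < q ^ k) by now apply pow_lt.
    specialize (IH (S k)).
    assert (0 < q ^ k / RR_denom q (S k) n) by (apply Rdiv_lt_0_compat; lra).
    lra.
Qed.

Lemma RR_denom_step (q : R) (n : nat) :
  0 < q < 1 ->
  forall k, Rabs (RR_denom q (S k) (S n) - RR_denom q (S k) n) <= q ^ S n.
Proof.
  intros Hq; induction n as [|n IH]; intros k.
  - simpl.
    assert (0 < q ^ k) by (apply pow_lt; lra).
    assert (q ^ k <= 1) by (rewrite <- (pow1 k); apply pow_incr; lra).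
    rewrite Rabs_pos_eq; [|nra].
    nra.
  - specialize (IH (S k)).
    change (RR_denom q (S k) (S (S n)))
      with (1 + q ^ S k / RR_denom q (S (S k)) (S n)).
    change (RR_denom q (S k) (S n))
      with (1 + q ^ S k / RR_denom q (S (S k)) n).
    pose proof (RR_denom_ge1 q (S n) (proj1 Hq) (S (S k))) as H1.
    pose proof (RR_denom_ge1 q n (proj1 Hq) (S (S k))) as H0.
    set (x := RR_denom q (S (S k)) (S n)) in *.
    set (y := RR_denom q (S (S k)) n) in *.
    replace (1 + q ^ S k / x - (1 + q ^ S k / y))
      with (q ^ S k * / (x * y) * (- (x - y))) by (field; lra).
    rewrite !Rabs_mult, Rabs_Ropp.
    assert (0 < q ^ k) by (apply pow_lt; lra).
    assert (q ^ k <= 1) by (rewrite <- (pow1 k); apply pow_incr; lra).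
    assert (Hk : 0 <= q ^ S k <= q) by (simpl; nra).
    assert (Hxy : 0 <= / (x * y) <= 1).
    { split; [left; apply Rinv_0_lt_compat; nra|].
      replace 1 with (/ 1) by field; apply Rinv_le_contravar; nra. }
    rewrite (Rabs_pos_eq (q ^ S k)), (Rabs_pos_eq (/ (x * y))) by lra.
    rewrite <- (tech_pow_Rmult q (S n)).
    apply Rmult_le_compat; try apply Rabs_pos; [nra|nra|exact IH].
Qed.

Lemma RR_denom_lim (q : R) :
  0 < q < 1 -> ex_finite_lim_seq (RR_denom q 1).
Proof.
  intros Hq.
  assert (Hs : ex_series
    (fun n => RR_denom q 1 (S n) - RR_denom q 1 n)).
  { apply (@ex_series_le R_AbsRing R_CompleteNormedModule _
      (fun n => q ^ S n)).
    - intros n; apply RR_denom_step, Hq.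
    - apply (ex_series_incr_1 (fun n => q ^ n)), ex_series_geom.
      rewrite Rabs_pos_eq; lra. }
  destruct Hs as [l Hl].
  exists (1 + l).
  apply is_lim_seq_incr_1.
  apply (is_lim_seq_ext
    (fun n => 1 + sum_n (fun n => RR_denom q 1 (S n) - RR_denom q 1 n) n)).
  - intros n; induction n as [|n IH].
    + rewrite sum_O; simpl; lra.
    + rewrite sum_Sn; change plus with Rplus; cbv beta.
      rewrite <- Rplus_assoc, IH; ring.
  - apply (is_lim_seq_plus' _ _ 1 l); [apply is_lim_seq_const|exact Hl].
Qed.

Lemma RR_convergent_lim (q : R) :
  0 < q < 1 -> is_lim_seq (RR_convergent q) (RogersRamanujan q).
Proof.
  intros Hq.
  destruct (RR_denom_lim q Hq) as [l Hl].
  assert (Hl1 : 1 <= l).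
  { apply (is_lim_seq_le (fun _ => 1) (RR_denom q 1) 1 l).
    - intros n; apply RR_denom_ge1, Hq.
    - apply is_lim_seq_const.
    - exact Hl. }
  assert (H : is_lim_seq (RR_convergent q) (Rpower q (1 / 5) / l)).
  { apply is_lim_seq_div'; [apply is_lim_seq_const|exact Hl|lra]. }
  unfold RogersRamanujan; rewrite (is_lim_seq_unique _ _ H); exact H.
Qed.

(* Main.v *)
Require Import Defs.
From Stdlib Require Import Reals Lra Lia ZArith List Permutation Classical ClassicalEpsilon.
From Coquelicot Require Import Coquelicot.
Import ListNotations.
Open Scope R_scope.

(* Following Hardy and Wright, R(q) is a quotient of two theta series in the nome
   q^(5/2). Decomposing Z^2 along the Gaussian integers 1 + i and 2 + i gives, without any
   infinite product, the classical relation
     1 / R^5 - 11 - R^5 = m2^4 m3 m4   at   q = exp(-4t),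
   where m_j = theta_j(t) / theta_j(5t) and theta_j(t) has nome exp(-t); it also gives
   a parametrization of the triple (m2, m3, m4) by quantities a, b, c.

   For q = exp(- PI sqrt(48/5)), i.e. t = PI sqrt(3/5), the inversion of theta functions
   exchanges t and 5t/3, and the cubic theta identity, a rotation by 60 degrees in a
   hexagonal lattice, relates 5t/3 and 5t. Together with the degree 5 relations this yields
   16 a^2 - 12 a + 1 = 0, and then all m_j. The inversion formula comes from Polya's finite
   identity between binomial coefficients and powers of cosines. *)

(** * Unconditional sums *)

(** Products of theta series are double series regrouped along sublattices, so summation is set up
    without any order on the index type, and reindexing along an injection serves as the change of
    variables. Without product formulas, the positivity of the alternating theta values, on which
    the divisions rely, is carried down from large arguments by duplication. The degree 5 relations
    leave one free parameter [a]: they determine [b] and [c], and Jacobi's quartic identity at t and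
    5t then determines the moduli at 5t. They also imply a (m2 + m4) = m3, while the inverted cubic
    identity reads d (m2 + m4) = m3 with d = theta_2 theta_4 / theta_3^2 at 5t. Hence d = a, and
    this single extra equation becomes a polynomial in [a] alone. A numerical bound on theta_3
    decides which root occurs. *)

Definition lsum {T} (f : T -> R) (l : list T) : R :=
  fold_right (fun x s => f x + s) 0 l.

(** Convergence along the finite subsets of [T], encoded as duplicate-free lists [B]; the threshold
    [A] may contain repetitions, since only membership in it matters. *)
Definition has_sum {T} (f : T -> R) (s : R) : Prop :=
  forall eps, 0 < eps -> exists A, forall B, NoDup B -> incl A B ->
  Rabs (lsum f B - s) < eps.

Definition abs_bounded {T} (f : T -> R) (M : R) : Prop :=
  forall B, NoDup B -> lsum (fun x => Rabs (f x)) B <= M.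

(** Total, with an unspecified value when no sum exists; existence is supplied separately, as in
    [Th_has_sum]. *)
Definition Sum {T} (f : T -> R) : R := epsilon (inhabits 0) (has_sum f).

Lemma lsum_app {T} (f : T -> R) l1 l2 : lsum f (l1 ++ l2) = lsum f l1 + lsum f l2.
Proof. induction l1; simpl; lra. Qed.

Lemma lsum_perm {T} (f : T -> R) l1 l2 : Permutation l1 l2 -> lsum f l1 = lsum f l2.
Proof. induction 1; simpl; lra. Qed.

Lemma lsum_ext_in {T} (f g : T -> R) l :
  (forall x, In x l -> f x = g x) -> lsum f l = lsum g l.
Proof.
  induction l as [|x l IH]; simpl; intros H; [easy|].
  rewrite H, IH; auto.
Qed.

Lemma lsum_ext {T} (f g : T -> R) l : (forall x, f x = g x) -> lsum f l = lsum g l.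
Proof. intros H; apply lsum_ext_in; auto. Qed.

Lemma lsum_plus {T} (f g : T -> R) l : lsum (fun x => f x + g x) l = lsum f l + lsum g l.
Proof. induction l; simpl; lra. Qed.

Lemma lsum_scal {T} (c : R) (f : T -> R) l : lsum (fun x => c * f x) l = c * lsum f l.
Proof. induction l as [|x l IH]; simpl; [|rewrite IH]; ring. Qed.

Lemma lsum_le {T} (f g : T -> R) l : (forall x, f x <= g x) -> lsum f l <= lsum g l.
Proof. intros H; induction l as [|x l IH]; simpl; [lra|specialize (H x); lra]. Qed.

Lemma lsum_nonneg {T} (f : T -> R) l : (forall x, 0 <= f x) -> 0 <= lsum f l.
Proof. intros H; induction l as [|x l IH]; simpl; [lra|specialize (H x); lra]. Qed.

Lemma lsum_Rabs {T} (f : T -> R) l : Rabs (lsum f l) <= lsum (fun x => Rabs (f x)) l.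
Proof.
  induction l as [|x l IH]; simpl; [rewrite Rabs_R0; lra|].
  eapply Rle_trans; [apply Rabs_triang|lra].
Qed.

Lemma lsum_map {T U} (f : T -> R) (g : U -> T) l : lsum f (map g l) = lsum (fun u => f (g u)) l.
Proof. induction l as [|x l IH]; simpl; [|rewrite IH]; easy. Qed.

Lemma lsum_zero {T} (f : T -> R) l : (forall x, In x l -> f x = 0) -> lsum f l = 0.
Proof.
  induction l as [|x l IH]; simpl; intros H; [easy|].
  rewrite H, IH; auto; ring.
Qed.

Lemma lsum_list_prod {T U} (f : T -> R) (g : U -> R) l1 l2 :
  lsum (fun p => f (fst p) * g (snd p)) (list_prod l1 l2) = lsum f l1 * lsum g l2.
Proof.
  induction l1 as [|x l1 IH]; simpl; [ring|].
  rewrite lsum_app, IH, lsum_map; simpl; rewrite lsum_scal; ring.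
Qed.

Lemma NoDup_list_prod' {T U} (l1 : list T) (l2 : list U) :
  NoDup l1 -> NoDup l2 -> NoDup (list_prod l1 l2).
Proof.
  intros H1 H2; induction H1 as [|x l1 Hx H1 IH]; simpl; [constructor|].
  apply NoDup_app; [|exact IH|].
  - apply FinFun.Injective_map_NoDup; [|exact H2]. intros a b E; congruence.
  - intros [a b] Ha Hb. apply in_map_iff in Ha; destruct Ha as [y [E _]].
    apply in_prod_iff in Hb; destruct Hb; congruence.
Qed.

Lemma nodup_cover {T} (A : list T) : exists B, NoDup B /\ incl A B /\ incl B A.
Proof.
  induction A as [|x A [B [H1 [H2 H3]]]].
  - exists []; repeat split; [constructor|easy|easy].
  - destruct (classic (In x B)) as [H|H].
    + exists B; repeat split; auto.
      * intros y [<-|Hy]; auto.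
      * intros y Hy; right; auto.
    + exists (x :: B); repeat split.
      * now constructor.
      * intros y [<-|Hy]; [now left|right; auto].
      * intros y [<-|Hy]; [now left|right; auto].
Qed.

Lemma split_incl {T} (A B : list T) : NoDup A -> NoDup B -> incl A B ->
  exists C, Permutation B (A ++ C) /\ NoDup C /\ (forall x, In x C -> ~ In x A).
Proof.
  intros HA; revert B; induction HA as [|x A Hx HA IH]; intros B HB HI.
  - exists B; simpl; repeat split; auto.
  - destruct (in_split x B) as [B1 [B2 E]]; [apply HI; now left|].
    assert (P : Permutation B (x :: B1 ++ B2)) by (subst; symmetry; apply Permutation_middle).
    assert (N : NoDup (x :: B1 ++ B2)) by (eapply Permutation_NoDup; eauto).
    inversion N as [|? ? N1 N2]; subst.
    destruct (IH (B1 ++ B2) N2) as [C [PC [NC DC]]].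
    { intros y Hy.
      assert (Iy : In y (x :: B1 ++ B2)) by (eapply Permutation_in; [exact P|apply HI; now right]).
      destruct Iy as [<-|Iy]; [contradiction|exact Iy]. }
    exists C; repeat split; auto.
    + rewrite P; simpl; constructor; exact PC.
    + intros y Hy [<-|Hy']; [|eapply DC; eauto].
      apply N1; eapply Permutation_in; [symmetry; exact PC|apply in_or_app; now right].
Qed.

Lemma lsum_incl_le {T} (f : T -> R) A B : (forall x, 0 <= f x) ->
  NoDup A -> NoDup B -> incl A B -> lsum f A <= lsum f B.
Proof.
  intros Hf HA HB HI; destruct (split_incl A B HA HB HI) as [C [P _]].
  rewrite (lsum_perm _ _ _ P), lsum_app.
  pose proof (lsum_nonneg f C Hf); lra.
Qed.

Lemma has_sum_unique {T} (f : T -> R) s t : has_sum f s -> has_sum f t -> s = t.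
Proof.
  intros Hs Ht; apply NNPP; intros D.
  assert (E : 0 < Rabs (s - t) / 2).
  { assert (0 < Rabs (s - t)) by (apply Rabs_pos_lt; lra); lra. }
  destruct (Hs _ E) as [A HA]; destruct (Ht _ E) as [B HB].
  destruct (nodup_cover (A ++ B)) as [C [NC [IC _]]].
  specialize (HA C NC (fun x h => IC x (in_or_app _ _ _ (or_introl h)))).
  specialize (HB C NC (fun x h => IC x (in_or_app _ _ _ (or_intror h)))).
  revert HA HB; unfold Rabs; repeat destruct Rcase_abs; lra.
Qed.

Lemma Sum_unique {T} (f : T -> R) s : has_sum f s -> Sum f = s.
Proof.
  intros H; apply (has_sum_unique f); [|exact H].
  unfold Sum; apply epsilon_spec; now exists s.
Qed.

Lemma has_sum_ext {T} (f g : T -> R) s : (forall x, f x = g x) -> has_sum f s -> has_sum g s.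
Proof.
  intros E H eps He; destruct (H eps He) as [A HA]; exists A; intros B NB IB.
  rewrite <- (lsum_ext f g B E); auto.
Qed.

Lemma has_sum_plus {T} (f g : T -> R) s t :
  has_sum f s -> has_sum g t -> has_sum (fun x => f x + g x) (s + t).
Proof.
  intros Hs Ht eps He.
  destruct (Hs (eps / 2)) as [A HA]; [lra|]; destruct (Ht (eps / 2)) as [B HB]; [lra|].
  exists (A ++ B); intros C NC IC.
  specialize (HA C NC (fun x h => IC x (in_or_app _ _ _ (or_introl h)))).
  specialize (HB C NC (fun x h => IC x (in_or_app _ _ _ (or_intror h)))).
  rewrite lsum_plus.
  replace (lsum f C + lsum g C - (s + t)) with ((lsum f C - s) + (lsum g C - t)) by ring.
  eapply Rle_lt_trans; [apply Rabs_triang|lra].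
Qed.

Lemma has_sum_scal {T} c (f : T -> R) s : has_sum f s -> has_sum (fun x => c * f x) (c * s).
Proof.
  intros Hs eps He.
  assert (Hc : 0 < Rabs c + 1) by (pose proof (Rabs_pos c); lra).
  destruct (Hs (eps / (Rabs c + 1))) as [A HA]; [now apply Rdiv_lt_0_compat|].
  exists A; intros B NB IB; specialize (HA B NB IB).
  rewrite lsum_scal, <- Rmult_minus_distr_l, Rabs_mult.
  apply Rle_lt_trans with ((Rabs c + 1) * Rabs (lsum f B - s)).
  - pose proof (Rabs_pos (lsum f B - s)); nra.
  - apply (Rmult_lt_compat_l _ _ _ Hc) in HA.
    replace ((Rabs c + 1) * (eps / (Rabs c + 1))) with eps in HA by (field; lra); exact HA.
Qed.

Lemma has_sum_minus {T} (f g : T -> R) s t :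
  has_sum f s -> has_sum g t -> has_sum (fun x => f x - g x) (s - t).
Proof.
  intros Hs Ht. replace (s - t) with (s + (-1) * t) by ring.
  apply (has_sum_ext (fun x => f x + (-1) * g x)); [intros; ring|].
  apply has_sum_plus, has_sum_scal; assumption.
Qed.

Lemma has_sum_finite {T} (f : T -> R) A :
  NoDup A -> (forall x, ~ In x A -> f x = 0) -> has_sum f (lsum f A).
Proof.
  intros NA H eps He; exists A; intros B NB IB.
  destruct (split_incl A B NA NB IB) as [C [P [NC D]]].
  rewrite (lsum_perm _ _ _ P), lsum_app, (lsum_zero f C) by auto.
  rewrite Rplus_0_r, Rminus_diag, Rabs_R0; exact He.
Qed.

Lemma lsum_preimage {T U} (f : T -> R) (g : U -> T) (B : list T) :
  (forall u v, g u = g v -> u = v) -> (forall x, f x <> 0 -> exists u, g u = x) -> NoDup B ->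
  exists C, NoDup C /\ (forall u, In u C <-> In (g u) B) /\ lsum f B = lsum (fun u => f (g u)) C.
Proof.
  intros Hi Hs NB; induction NB as [|x B Hx NB [C [NC [IC EC]]]].
  - exists []; simpl; repeat split; auto; constructor.
  - destruct (classic (exists u, g u = x)) as [[u Hu]|H].
    + exists (u :: C); split; [|split].
      * constructor; [|exact NC]; rewrite IC, Hu; exact Hx.
      * intros v; simpl; rewrite IC; split; intros [E|E]; auto.
        -- subst; now left.
        -- left; apply Hi; congruence.
      * simpl; rewrite EC, Hu; easy.
    + exists C; split; [exact NC|split].
      * intros v; simpl; rewrite IC; split; [now right|intros [E|E]; [|exact E]].
        exfalso; apply H; exists v; easy.
      * simpl; rewrite EC.
        destruct (Req_dec (f x) 0) as [E|E]; [rewrite E; ring|].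
        exfalso; auto.
Qed.

(** A finite set meets the image of [g] in a finite preimage, and the rest of it lies where [f]
    vanishes. As [g] need only reach the support of [f], sums restricted to a coset are covered. *)
Lemma has_sum_inj {T U} (f : T -> R) (g : U -> T) s :
  (forall u v, g u = g v -> u = v) -> (forall x, f x <> 0 -> exists u, g u = x) ->
  has_sum (fun u => f (g u)) s -> has_sum f s.
Proof.
  intros Hi Hs H eps He; destruct (H eps He) as [A HA].
  exists (map g A); intros B NB IB.
  destruct (lsum_preimage f g B Hi Hs NB) as [C [NC [IC EC]]].
  rewrite EC; apply HA; [exact NC|].
  intros u Hu; apply IC, IB, in_map, Hu.
Qed.

Lemma abs_bounded_comp {T U} (f : T -> R) (g : U -> T) M :
  (forall u v, g u = g v -> u = v) -> abs_bounded f M -> abs_bounded (fun u => f (g u)) M.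
Proof.
  intros Hi H B NB; rewrite <- (lsum_map (fun x => Rabs (f x)) g).
  apply H, FinFun.Injective_map_NoDup; auto.
Qed.

Lemma abs_bounded_le {T} (f g : T -> R) M :
  (forall x, Rabs (f x) <= Rabs (g x)) -> abs_bounded g M -> abs_bounded f M.
Proof. intros H Hg B NB; eapply Rle_trans; [apply lsum_le; exact H|auto]. Qed.

Lemma has_sum_exists_nonneg {T} (f : T -> R) M :
  (forall x, 0 <= f x) -> abs_bounded f M -> exists s, has_sum f s.
Proof.
  intros Hf HM.
  destruct (completeness (fun y => exists B, NoDup B /\ y = lsum f B)) as [s [U L]].
  - exists M; intros y [B [NB ->]].
    rewrite (lsum_ext f (fun x => Rabs (f x))); [auto|].
    intros x; rewrite Rabs_pos_eq; auto.
  - exists 0, []; split; [constructor|easy].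
  - exists s; intros eps He.
    apply NNPP; intros D.
    assert (s <= s - eps); [|lra].
    apply L; intros y [B [NB ->]].
    apply Rnot_lt_le; intros Hlt; apply D; exists B; intros B' NB' IB'.
    pose proof (lsum_incl_le f B B' Hf NB NB' IB').
    assert (lsum f B' <= s) by (apply U; now exists B').
    apply Rabs_def1; lra.
Qed.

(** Writes [f] as [Rabs f - (Rabs f - f)], a difference of two nonnegative bounded families. *)
Lemma has_sum_exists {T} (f : T -> R) M : abs_bounded f M -> exists s, has_sum f s.
Proof.
  intros H.
  destruct (has_sum_exists_nonneg (fun x => Rabs (f x)) M) as [s1 H1].
  { intros x; apply Rabs_pos. }
  { eapply abs_bounded_le; [|exact H]; intros x; rewrite Rabs_Rabsolu; lra. }
  destruct (has_sum_exists_nonneg (fun x => Rabs (f x) - f x) (2 * M)) as [s2 H2].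
  { intros x; pose proof (Rle_abs (f x)); lra. }
  { intros B NB; apply Rle_trans with (lsum (fun x => 2 * Rabs (f x)) B).
    - apply lsum_le; intros x; rewrite Rabs_pos_eq.
      + unfold Rabs; destruct Rcase_abs; lra.
      + pose proof (Rle_abs (f x)); lra.
    - rewrite lsum_scal; specialize (H B NB); lra. }
  exists (s1 - s2).
  apply (has_sum_ext (fun x => Rabs (f x) - (Rabs (f x) - f x))); [intros; ring|].
  now apply has_sum_minus.
Qed.

Lemma has_sum_le_bound {T} (f : T -> R) s M :
  (forall B, NoDup B -> lsum f B <= M) -> has_sum f s -> s <= M.
Proof.
  intros HM H; apply Rnot_lt_le; intros D.
  destruct (H (s - M)) as [A HA]; [lra|].
  destruct (nodup_cover A) as [B [NB [IB _]]].
  specialize (HA B NB IB); specialize (HM B NB).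
  apply Rabs_def2 in HA; lra.
Qed.

Lemma has_sum_ge_finite {T} (f : T -> R) s A :
  (forall x, 0 <= f x) -> NoDup A -> has_sum f s -> lsum f A <= s.
Proof.
  intros Hf NA H; apply Rnot_lt_le; intros D.
  destruct (H (lsum f A - s)) as [A' HA]; [lra|].
  destruct (nodup_cover (A ++ A')) as [B [NB [IB _]]].
  specialize (HA B NB (fun x h => IB x (in_or_app _ _ _ (or_intror h)))).
  pose proof (lsum_incl_le f A B Hf NA NB (fun x h => IB x (in_or_app _ _ _ (or_introl h)))).
  apply Rabs_def2 in HA; lra.
Qed.

Lemma abs_bounded_prod {T U} (f : T -> R) (g : U -> R) M N :
  abs_bounded f M -> abs_bounded g N ->
  abs_bounded (fun p => f (fst p) * g (snd p)) (M * N).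
Proof.
  intros HM HN B NB.
  destruct (nodup_cover (map fst B)) as [B1 [N1 [I1 _]]].
  destruct (nodup_cover (map snd B)) as [B2 [N2 [I2 _]]].
  apply Rle_trans with (lsum (fun p => Rabs (f (fst p)) * Rabs (g (snd p))) (list_prod B1 B2)).
  - rewrite (lsum_ext _ (fun p => Rabs (f (fst p)) * Rabs (g (snd p)))) by (intros; apply Rabs_mult).
    apply lsum_incl_le; auto.
    + intros p; apply Rmult_le_pos; apply Rabs_pos.
    + now apply NoDup_list_prod'.
    + intros [x y] Hp; apply in_prod; [apply I1|apply I2].
      * change x with (fst (x, y)); now apply in_map.
      * change y with (snd (x, y)); now apply in_map.
  - rewrite (lsum_list_prod (fun x => Rabs (f x)) (fun x => Rabs (g x))).
    specialize (HM B1 N1); specialize (HN B2 N2).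
    apply Rmult_le_compat; auto; apply lsum_nonneg; intros; apply Rabs_pos.
Qed.

(** A sum exists by absolute boundedness, so only its value must be found; it is read off on a
    rectangle [list_prod B1 B2] large enough for all three sums. *)
Lemma has_sum_prod {T U} (f : T -> R) (g : U -> R) M N s t :
  abs_bounded f M -> abs_bounded g N -> has_sum f s -> has_sum g t ->
  has_sum (fun p => f (fst p) * g (snd p)) (s * t).
Proof.
  intros HM HN Hs Ht.
  destruct (has_sum_exists _ _ (abs_bounded_prod f g M N HM HN)) as [v Hv].
  replace (s * t) with v; [exact Hv|].
  apply NNPP; intros D.
  assert (E : 0 < Rabs (v - s * t)) by (apply Rabs_pos_lt; lra).
  set (e := Rabs (v - s * t)) in *.
  (* Chosen for the expansion [(a - s) * (b - t) + s * (b - t) + (a - s) * t]: factors of size at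
     most [d <= 1] keep it below [d * K <= e / 2]. *)
  set (K := Rabs s + Rabs t + 1).
  assert (HK : 1 <= K) by (unfold K; pose proof (Rabs_pos s); pose proof (Rabs_pos t); lra).
  set (d := Rmin 1 (e / (2 * K))).
  assert (Hd : 0 < d).
  { apply Rmin_glb_lt; [lra|apply Rdiv_lt_0_compat; lra]. }
  assert (Hd1 : d <= 1) by apply Rmin_l.
  assert (Hd2 : d * K <= e / 2).
  { replace (e / 2) with (e / (2 * K) * K) by (field; lra).
    apply Rmult_le_compat_r; [lra|apply Rmin_r]. }
  destruct (Hs d Hd) as [A1 H1]; destruct (Ht d Hd) as [A2 H2].
  destruct (Hv (e / 2)) as [A H]; [lra|].
  destruct (nodup_cover (A1 ++ map fst A)) as [B1 [N1 [I1 _]]].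
  destruct (nodup_cover (A2 ++ map snd A)) as [B2 [N2 [I2 _]]].
  specialize (H1 B1 N1 (fun x h => I1 x (in_or_app _ _ _ (or_introl h)))).
  specialize (H2 B2 N2 (fun x h => I2 x (in_or_app _ _ _ (or_introl h)))).
  specialize (H (list_prod B1 B2) (NoDup_list_prod' _ _ N1 N2)).
  rewrite lsum_list_prod in H.
  assert (HI : incl A (list_prod B1 B2)).
  { intros [x y] Hp; apply in_prod; [apply I1|apply I2]; apply in_or_app; right.
    - change x with (fst (x, y)); now apply in_map.
    - change y with (snd (x, y)); now apply in_map. }
  specialize (H HI).
  set (a := lsum f B1) in *; set (b := lsum g B2) in *.
  assert (Q : Rabs (a * b - s * t) <= d * K).
  { replace (a * b - s * t) with ((a - s) * (b - t) + s * (b - t) + (a - s) * t) by ring.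
    eapply Rle_trans; [apply Rabs_triang|].
    eapply Rle_trans; [apply Rplus_le_compat_r, Rabs_triang|].
    rewrite !Rabs_mult; unfold K.
    pose proof (Rabs_pos (a - s)); pose proof (Rabs_pos (b - t));
    pose proof (Rabs_pos s); pose proof (Rabs_pos t).
    assert (Rabs (a - s) * Rabs (b - t) <= d * 1) by (apply Rmult_le_compat; lra).
    assert (Rabs s * Rabs (b - t) <= Rabs s * d) by (apply Rmult_le_compat_l; lra).
    assert (Rabs (a - s) * Rabs t <= d * Rabs t) by (apply Rmult_le_compat_r; lra).
    lra. }
  assert (X : e <= Rabs (a * b - v) + Rabs (a * b - s * t)).
  { unfold e; replace (v - s * t) with (- (a * b - v) + (a * b - s * t)) by ring.
    eapply Rle_trans; [apply Rabs_triang|rewrite Rabs_Ropp; lra]. }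
  lra.
Qed.

(** * Uniform tails and dominated convergence *)

Lemma abs_bounded_tail {T} (g : T -> R) M : (forall x, 0 <= g x) -> abs_bounded g M ->
  forall eps, 0 < eps -> exists A, NoDup A /\
  forall C, NoDup C -> (forall x, In x C -> ~ In x A) -> lsum g C < eps.
Proof.
  intros Hg HM eps He.
  destruct (has_sum_exists_nonneg g M Hg HM) as [s Hs].
  destruct (Hs (eps / 2)) as [A0 HA0]; [lra|].
  destruct (nodup_cover A0) as [A [NA [IA _]]].
  exists A; split; [exact NA|]; intros C NC D.
  pose proof (HA0 A NA IA) as H1.
  assert (NAC : NoDup (A ++ C)).
  { apply NoDup_app; auto; intros x Hx Hx'; eapply D; eauto. }
  pose proof (HA0 (A ++ C) NAC (fun x h => in_or_app _ _ _ (or_introl (IA x h)))) as H2.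
  rewrite lsum_app in H2; apply Rabs_def2 in H1; apply Rabs_def2 in H2; lra.
Qed.

Lemma is_lim_seq_lsum {T} (f : nat -> T -> R) (g : T -> R) A :
  (forall x, is_lim_seq (fun k => f k x) (g x)) ->
  is_lim_seq (fun k => lsum (f k) A) (lsum g A).
Proof.
  intros H; induction A as [|x A IH]; simpl; [apply is_lim_seq_const|].
  apply (is_lim_seq_plus' _ _ _ _ (H x) IH).
Qed.

Lemma has_sum_dominated_tail {T} (f g : T -> R) s A eps :
  (forall x, Rabs (f x) <= g x) -> NoDup A -> 0 < eps ->
  (forall C, NoDup C -> (forall x, In x C -> ~ In x A) -> lsum g C < eps) ->
  has_sum f s -> Rabs (s - lsum f A) < 2 * eps.
Proof.
  intros Hb NA He Ht Hs.
  destruct (Hs eps He) as [A' HA'].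
  destruct (nodup_cover (A ++ A')) as [B [NB [IB _]]].
  specialize (HA' B NB (fun x h => IB x (in_or_app _ _ _ (or_intror h)))).
  destruct (split_incl A B NA NB (fun x h => IB x (in_or_app _ _ _ (or_introl h))))
    as [C [P [NC D]]].
  specialize (Ht C NC D).
  rewrite (lsum_perm _ _ _ P), lsum_app in HA'.
  pose proof (lsum_Rabs f C); pose proof (lsum_le _ _ C Hb).
  assert (Q : Rabs (lsum f C) < eps) by lra.
  apply Rabs_def2 in Q; apply Rabs_def2 in HA'; apply Rabs_def1; lra.
Qed.

Lemma dominated_convergence {T} (f : nat -> T -> R) (h g : T -> R) M (s : nat -> R) s' :
  abs_bounded g M -> (forall k x, Rabs (f k x) <= g x) ->
  (forall x, is_lim_seq (fun k => f k x) (h x)) ->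
  (forall k, has_sum (f k) (s k)) -> has_sum h s' -> is_lim_seq s s'.
Proof.
  intros HM Hb Hl Hs Hs'.
  destruct (classic (inhabited T)) as [[x0]|HT].
  2:{ assert (E : forall f' t, has_sum (T:=T) f' t -> t = 0).
      { intros f' t Ht; apply (has_sum_unique f'); [exact Ht|].
        apply (has_sum_finite f' []); [constructor|].
        intros x; exfalso; apply HT; now exists. }
      rewrite (E _ _ Hs').
      apply (is_lim_seq_ext (fun _ => 0)); [|apply is_lim_seq_const].
      intros n; symmetry; eapply E, Hs. }
  assert (Hg : forall x, 0 <= g x).
  { intros x; eapply Rle_trans; [apply Rabs_pos|apply (Hb 0%nat)]. }
  assert (Hh : forall x, Rabs (h x) <= g x).
  { intros x. apply (is_lim_seq_le (fun k => Rabs (f k x)) (fun _ => g x) (Rabs (h x)) (g x)).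
    - intros; apply Hb.
    - apply (is_lim_seq_abs _ (h x)), Hl.
    - apply is_lim_seq_const. }
  apply is_lim_seq_spec; intros eps.
  (* The two tails cost less than [2 * (eps / 5)] each, the finite part over [A] less than
     [eps / 5]. *)
  destruct (abs_bounded_tail g M Hg HM (eps / 5)) as [A [NA HA]]; [destruct eps; simpl; lra|].
  pose proof (is_lim_seq_lsum f h A Hl) as L.
  apply is_lim_seq_spec in L.
  assert (He : 0 < eps / 5) by (destruct eps; simpl; lra).
  destruct (L (mkposreal _ He)) as [N HN]; exists N; intros n Hn.
  specialize (HN n Hn); simpl in HN.
  pose proof (has_sum_dominated_tail _ _ _ _ _ (Hb n) NA He HA (Hs n)) as Q1.
  pose proof (has_sum_dominated_tail _ _ _ _ _ Hh NA He HA Hs') as Q2.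
  apply Rabs_def2 in HN; apply Rabs_def2 in Q1; apply Rabs_def2 in Q2.
  apply Rabs_def1; lra.
Qed.

(** * Theta series *)

Fixpoint interval (N : nat) : list Z :=
  match N with
  | O => [0%Z]
  | S N' => Z.of_nat N :: (- Z.of_nat N)%Z :: interval N'
  end.

Lemma interval_spec N n : In n (interval N) <-> (Z.abs n <= Z.of_nat N)%Z.
Proof.
  induction N as [|N IH]; cbn [interval In]; [|rewrite IH]; lia.
Qed.

Lemma interval_NoDup N : NoDup (interval N).
Proof.
  induction N as [|N IH]; cbn [interval].
  - repeat constructor; easy.
  - constructor; [|constructor; [|exact IH]].
    + intros [H|H]; [lia|apply interval_spec in H; lia].
    + intros H; apply interval_spec in H; lia.
Qed.

Lemma lsum_interval_geom r N : r <> 1 ->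
  lsum (fun n => r ^ Z.abs_nat n) (interval N) = (1 + r - 2 * r ^ S N) / (1 - r).
Proof.
  intros Hr; induction N as [|N IH].
  - simpl; field; lra.
  - cbn [interval lsum fold_right]; fold (lsum (fun n => r ^ Z.abs_nat n) (interval N)).
    replace (Z.abs_nat (Z.of_nat (S N))) with (S N) by lia.
    replace (Z.abs_nat (- Z.of_nat (S N))) with (S N) by lia.
    rewrite IH; simpl; field; lra.
Qed.

Lemma list_Z_bounded (B : list Z) : exists N, incl B (interval N).
Proof.
  induction B as [|x B [N HN]].
  - exists O; easy.
  - exists (Nat.max N (Z.abs_nat x)); intros y Hy; apply interval_spec.
    destruct Hy as [<-|Hy]; [lia|].
    apply HN, interval_spec in Hy; lia.
Qed.

Lemma abs_bounded_geom (f : Z -> R) C r : 0 < r < 1 -> 0 <= C ->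
  (forall n, Rabs (f n) <= C * r ^ Z.abs_nat n) -> abs_bounded f (C * ((1 + r) / (1 - r))).
Proof.
  intros Hr HC Hf B NB.
  destruct (list_Z_bounded B) as [N HN].
  assert (Hp : forall n, 0 < r ^ n) by (intros; apply pow_lt; lra).
  eapply Rle_trans; [apply lsum_le; exact Hf|].
  rewrite lsum_scal; apply Rmult_le_compat_l; [exact HC|].
  eapply Rle_trans; [apply (lsum_incl_le _ B (interval N))|].
  - intros; left; apply Hp.
  - exact NB.
  - apply interval_NoDup.
  - exact HN.
  - rewrite lsum_interval_geom by lra.
    apply Rmult_le_compat_r; [left; apply Rinv_0_lt_compat; lra|].
    specialize (Hp (S N)); lra.
Qed.

Lemma exp_pow x n : exp x ^ n = exp (INR n * x).
Proof.
  induction n as [|n IH]; [simpl; rewrite Rmult_0_l, exp_0; easy|].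
  rewrite S_INR; simpl pow; rewrite IH, <- exp_plus; f_equal; ring.
Qed.

Lemma exp_le_compat x y : x <= y -> exp x <= exp y.
Proof. intros [H| ->]; [left; now apply exp_increasing|lra]. Qed.

Lemma INR_Zabs_nat n : INR (Z.abs_nat n) = Rabs (IZR n).
Proof. rewrite INR_IZR_INZ, Zabs2Nat.id_abs, abs_IZR; easy. Qed.

(** A Gaussian lies below a geometric series because [x ^ 2 >= Rabs x - 1 / 4], which is
    [(Rabs x - 1 / 2) ^ 2 >= 0]. *)
Lemma abs_bounded_gauss t a (f : Z -> R) : 0 < t ->
  (forall n, Rabs (f n) <= exp (- (t * (IZR n + a) ^ 2))) -> exists M, abs_bounded f M.
Proof.
  intros Ht Hf; eexists; apply (abs_bounded_geom f (exp (t * (Rabs a + 1 / 4))) (exp (- t))).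
  - split; [apply exp_pos|rewrite <- exp_0; apply exp_increasing; lra].
  - left; apply exp_pos.
  - intros n; eapply Rle_trans; [apply Hf|].
    rewrite exp_pow, <- exp_plus, INR_Zabs_nat; apply exp_le_compat.
    enough (H : Rabs (IZR n) - Rabs a - 1 / 4 <= (IZR n + a) ^ 2).
    { apply (Rmult_le_compat_l t) in H; lra. }
    assert (H : Rabs (IZR n) - Rabs a <= Rabs (IZR n + a)).
    { pose proof (Rabs_triang (IZR n + a) (- a)) as H; rewrite Rabs_Ropp in H.
      replace (IZR n + a + - a) with (IZR n) in H by ring; lra. }
    rewrite <- pow2_abs; pose proof (pow2_ge_0 (Rabs (IZR n + a) - 1 / 2)); lra.
Qed.

(** The trivial character or (-1)^n, selected by a Boolean so that multiplying characters is
    [xorb]. *)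
Definition ch (e : bool) (n : Z) : R := if (e && Z.odd n)%bool then -1 else 1.

Definition theta_term (e : bool) (a t : R) (n : Z) : R :=
  ch e n * exp (- (t * (IZR n + a) ^ 2)).

(** [Th false (1 / 2)], [Th false 0] and [Th true 0] are Jacobi's theta_2, theta_3 and theta_4. *)
Definition Th (e : bool) (a t : R) : R := Sum (theta_term e a t).

Lemma ch_abs e n : Rabs (ch e n) = 1.
Proof. unfold ch; destruct (e && Z.odd n)%bool; [rewrite Rabs_left|rewrite Rabs_right]; lra. Qed.

Lemma theta_term_abs e a t n : Rabs (theta_term e a t n) = exp (- (t * (IZR n + a) ^ 2)).
Proof.
  unfold theta_term; rewrite Rabs_mult, ch_abs, Rmult_1_l, Rabs_pos_eq; [easy|left; apply exp_pos].
Qed.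

Lemma theta_term_bounded e a t : 0 < t -> exists M, abs_bounded (theta_term e a t) M.
Proof.
  intros Ht; apply (abs_bounded_gauss t a); [exact Ht|].
  intros n; rewrite theta_term_abs; lra.
Qed.

Lemma Th_has_sum e a t : 0 < t -> has_sum (theta_term e a t) (Th e a t).
Proof.
  intros Ht; destruct (theta_term_bounded e a t Ht) as [M HM].
  destruct (has_sum_exists _ _ HM) as [s Hs].
  unfold Th; rewrite (Sum_unique _ s); assumption.
Qed.

Lemma Th_prod_has_sum e a t d b u : 0 < t -> 0 < u ->
  has_sum (fun p => theta_term e a t (fst p) * theta_term d b u (snd p)) (Th e a t * Th d b u).
Proof.
  intros Ht Hu.
  destruct (theta_term_bounded e a t Ht) as [M HM]; destruct (theta_term_bounded d b u Hu) as [N HN].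
  eapply has_sum_prod; eauto; now apply Th_has_sum.
Qed.

Lemma theta_term_mul e a t m d b u n :
  theta_term e a t m * theta_term d b u n =
  ch e m * ch d n * exp (- (t * (IZR m + a) ^ 2 + u * (IZR n + b) ^ 2)).
Proof.
  unfold theta_term.
  replace (- (t * (IZR m + a) ^ 2 + u * (IZR n + b) ^ 2)) with
    (- (t * (IZR m + a) ^ 2) + - (u * (IZR n + b) ^ 2)) by ring.
  rewrite exp_plus; ring.
Qed.

Lemma Th_opp e a t : 0 < t -> Th e (- a) t = Th e a t.
Proof.
  intros Ht; apply Sum_unique, (has_sum_inj _ Z.opp); [lia| |].
  - intros x _; exists (- x)%Z; lia.
  - apply (has_sum_ext (theta_term e a t)); [|now apply Th_has_sum].
    intros n; unfold theta_term, ch; rewrite Z.odd_opp, opp_IZR.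
    do 2 f_equal; ring.
Qed.

Lemma Th_succ e a t : 0 < t -> Th e (a + 1) t = ch e 1 * Th e a t.
Proof.
  intros Ht; apply Sum_unique, (has_sum_inj _ Z.pred); [lia| |].
  - intros x _; exists (Z.succ x); lia.
  - apply (has_sum_ext (fun n => ch e 1 * theta_term e a t n)); [|now apply has_sum_scal, Th_has_sum].
    intros n; unfold theta_term, ch; rewrite Z.odd_pred, <- Z.negb_odd, <- Z.sub_1_r, minus_IZR.
    replace (IZR n - 1 + (a + 1)) with (IZR n + a) by ring.
    destruct e, (Z.odd n); simpl; ring.
Qed.

Lemma Th_reflect e a t : 0 < t -> Th e (1 - a) t = ch e 1 * Th e a t.
Proof.
  intros Ht; replace (1 - a) with (- a + 1) by ring.
  now rewrite Th_succ, Th_opp.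
Qed.

Lemma has_sum_class (F G : Z * Z -> R) (c : Z * Z -> bool) (phi : Z * Z -> Z * Z) s :
  (forall u v, phi u = phi v -> u = v) ->
  (forall z, c z = true -> exists u, phi u = z) ->
  (forall u, c (phi u) = true) -> (forall u, F (phi u) = G u) ->
  has_sum G s -> has_sum (fun z => if c z then F z else 0) s.
Proof.
  intros H1 H2 H3 H4 H; apply (has_sum_inj _ phi); [exact H1| |].
  - intros z Hz; apply H2; destruct (c z); [easy|exfalso; now apply Hz].
  - eapply has_sum_ext; [|exact H]; intros u; rewrite H3; auto.
Qed.

Ltac pair_inj :=
  let E := fresh in
  intros [? ?] [? ?] E; cbn [fst snd] in E;
  pose proof (f_equal fst E); pose proof (f_equal snd E); cbn [fst snd] in *; f_equal; lia.

Ltac izr := rewrite ?plus_IZR, ?minus_IZR, ?mult_IZR, ?opp_IZR.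

(* Splits the square lattice into the two cosets of the sublattice generated by
   (1,1) and (1,-1), which is a square lattice scaled by sqrt 2. *)
Lemma Th_mul_2 e d a b t : 0 < t ->
  Th e a t * Th d b t =
  Th (xorb e d) ((a + b) / 2) (2 * t) * Th (xorb e d) ((a - b) / 2) (2 * t) +
  ch e 1 * (Th (xorb e d) ((1 + a + b) / 2) (2 * t) * Th (xorb e d) ((1 + a - b) / 2) (2 * t)).
Proof.
  intros Ht.
  set (F := fun p : Z * Z => theta_term e a t (fst p) * theta_term d b t (snd p)).
  apply (has_sum_unique F); [now apply Th_prod_has_sum|].
  (* With m = i + j + r and n = i - j, the form (m + a)^2 + (n + b)^2 equals 2 (i + (r + a + b) /
     2)^2 + 2 (j + (r + a - b) / 2)^2, and the characters merge into [xorb e d] up to the constant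
     [ch e r]. *)
  assert (H : forall r, (0 <= r < 2)%Z ->
    has_sum (fun z => if ((fst z - snd z) mod 2 =? r)%Z then F z else 0)
      (ch e r * (Th (xorb e d) ((IZR r + a + b) / 2) (2 * t) *
                 Th (xorb e d) ((IZR r + a - b) / 2) (2 * t)))).
  { intros r Hr.
    eapply (has_sum_class F _ _ (fun p => (fst p + snd p + r, fst p - snd p)%Z));
      [pair_inj| | | |apply has_sum_scal, Th_prod_has_sum; lra].
    - intros [m n] E; apply Z.eqb_eq in E; cbn [fst snd] in *.
      pose proof (Z_div_mod_eq_full (m - n) 2).
      exists (m - (m - n) / 2 - r, (m - n) / 2)%Z; cbn [fst snd]; f_equal; lia.
    - intros [i j]; cbn [fst snd]; apply Z.eqb_eq.
      replace (i + j + r - (i - j))%Z with (r + j * 2)%Z by ring.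
      rewrite Z_mod_plus_full; now apply Z.mod_small.
    - intros [i j]; unfold F; cbn [fst snd]; rewrite !theta_term_mul, <- Rmult_assoc.
      f_equal.
      + unfold ch; rewrite !Z.odd_add, Z.odd_sub.
        destruct e, d, (Z.odd i), (Z.odd j), (Z.odd r); simpl; ring.
      + f_equal; izr; field. }
  pose proof (has_sum_plus _ _ _ _ (H 0%Z ltac:(lia)) (H 1%Z ltac:(lia))) as Q.
  replace (ch e 0) with 1 in Q by (destruct e; easy).
  rewrite Rmult_1_l, !Rplus_0_l in Q.
  eapply has_sum_ext; [|exact Q].
  intros [m n]; cbn [fst snd]; pose proof (Z.mod_pos_bound (m - n) 2 ltac:(lia)).
  destruct (Z.eqb_spec ((m - n) mod 2) 0), (Z.eqb_spec ((m - n) mod 2) 1); try lia; ring.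
Qed.

(* The same for the index 5 sublattice (2 + i) Z[i]. *)
Lemma Th_mul_5 e a b t : 0 < t ->
  Th e a t * Th e b t =
  Th e ((2 * a + b) / 5) (5 * t) * Th e ((2 * b - a) / 5) (5 * t) +
  Th e ((3 + 2 * a + b) / 5) (5 * t) * Th e ((1 + 2 * b - a) / 5) (5 * t) +
  Th e ((6 + 2 * a + b) / 5) (5 * t) * Th e ((2 + 2 * b - a) / 5) (5 * t) +
  Th e ((9 + 2 * a + b) / 5) (5 * t) * Th e ((3 + 2 * b - a) / 5) (5 * t) +
  Th e ((12 + 2 * a + b) / 5) (5 * t) * Th e ((4 + 2 * b - a) / 5) (5 * t).
Proof.
  intros Ht.
  set (F := fun p : Z * Z => theta_term e a t (fst p) * theta_term e b t (snd p)).
  apply (has_sum_unique F); [now apply Th_prod_has_sum|].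
  (* The point (2 i - j, i + 2 j) is the product of 2 + sqrt(-1) and i + j sqrt(-1). Residue r is
     represented by (r, r), whose even coordinate sum produces no sign. *)
  assert (H : forall r, (0 <= r < 5)%Z ->
    has_sum (fun z => if ((2 * snd z - fst z) mod 5 =? r)%Z then F z else 0)
      (Th e ((IZR (3 * r) + 2 * a + b) / 5) (5 * t) * Th e ((IZR r + 2 * b - a) / 5) (5 * t))).
  { intros r Hr.
    eapply (has_sum_class F _ _
      (fun p => (2 * fst p - snd p + r, fst p + 2 * snd p + r)%Z));
      [pair_inj| | | |apply Th_prod_has_sum; lra].
    - intros [m n] E; apply Z.eqb_eq in E; cbn [fst snd] in *.
      pose proof (Z_div_mod_eq_full (2 * n - m) 5).
      exists (n - 2 * ((2 * n - m) / 5) - r, (2 * n - m) / 5)%Z; cbn [fst snd]; f_equal; lia.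
    - intros [i j]; cbn [fst snd]; apply Z.eqb_eq.
      replace (2 * (i + 2 * j + r) - (2 * i - j + r))%Z with (r + j * 5)%Z by ring.
      rewrite Z_mod_plus_full; now apply Z.mod_small.
    - intros [i j]; unfold F; cbn [fst snd]; rewrite !theta_term_mul.
      f_equal.
      + unfold ch; rewrite !Z.odd_add, Z.odd_sub, !Z.odd_mul.
        destruct e, (Z.odd i), (Z.odd j), (Z.odd r); simpl; ring.
      + f_equal; izr; field. }
  pose proof (has_sum_plus _ _ _ _ (has_sum_plus _ _ _ _ (has_sum_plus _ _ _ _ (has_sum_plus _ _ _ _
    (H 0%Z ltac:(lia)) (H 1%Z ltac:(lia))) (H 2%Z ltac:(lia))) (H 3%Z ltac:(lia)))
    (H 4%Z ltac:(lia))) as Q.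
  change (3 * 0)%Z with 0%Z in Q; change (3 * 1)%Z with 3%Z in Q; change (3 * 2)%Z with 6%Z in Q;
    change (3 * 3)%Z with 9%Z in Q; change (3 * 4)%Z with 12%Z in Q.
  rewrite !Rplus_0_l in Q.
  eapply has_sum_ext; [|exact Q].
  intros [m n]; cbn [fst snd]; pose proof (Z.mod_pos_bound (2 * n - m) 5 ltac:(lia)).
  destruct (Z.eqb_spec ((2 * n - m) mod 5) 0), (Z.eqb_spec ((2 * n - m) mod 5) 1),
    (Z.eqb_spec ((2 * n - m) mod 5) 2), (Z.eqb_spec ((2 * n - m) mod 5) 3),
    (Z.eqb_spec ((2 * n - m) mod 5) 4); try lia; ring.
Qed.

(* Rotation by 60 degrees in the lattice of the form m^2 + 3 n^2. *)
Lemma Th_cubic t : 0 < t ->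
  Th false 0 t * Th false 0 (3 * t) =
  Th true 0 t * Th true 0 (3 * t) + Th false (1 / 2) t * Th false (1 / 2) (3 * t).
Proof.
  intros Ht.
  set (F := fun p : Z * Z => theta_term false 0 t (fst p) * theta_term false 0 (3 * t) (snd p)).
  set (K := fun p : Z * Z =>
    theta_term false (1 / 2) t (fst p) * theta_term false (1 / 2) (3 * t) (snd p)).
  set (g := fun p : Z * Z => (fst p + 2 * snd p + 1, fst p)%Z).
  assert (Hg : forall u v, g u = g v -> u = v) by (unfold g; pair_inj).
  assert (HF : exists M, abs_bounded F M).
  { destruct (theta_term_bounded false 0 t Ht) as [M HM].
    destruct (theta_term_bounded false 0 (3 * t) ltac:(lra)) as [N HN].
    eexists; apply abs_bounded_prod; eauto. }
  destruct HF as [M HM].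
  destruct (has_sum_exists _ _ (abs_bounded_comp F g M Hg HM)) as [s Hs].
  assert (Hodd : has_sum (fun z => if Z.odd (fst z + snd z) then F z else 0) s).
  { eapply (has_sum_class F _ _ g); [exact Hg| | |reflexivity|exact Hs].
    - intros [m n] E; cbn [fst snd] in E; apply Z.odd_spec in E; destruct E as [k E].
      exists (n, k - n)%Z; unfold g; cbn [fst snd]; f_equal; lia.
    - intros [u v]; unfold g; cbn [fst snd].
      replace (u + 2 * v + 1 + u)%Z with (1 + 2 * (u + v))%Z by ring.
      rewrite Z.odd_add_mul_2; easy. }
  (* Both parity classes of the shifted lattice carry the same form 4 (u^2 + u (v + 1/2) + (v +
     1/2)^2) as the odd class of the unshifted one, hence the same sum [s]. The theta_2 product is
     therefore [s + s], and so is the difference of the theta_3 and theta_4 products, in which the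
     even class cancels. *)
  assert (K0 : has_sum (fun z => if Z.even (fst z - snd z) then K z else 0) s).
  { eapply (has_sum_class K _ _ (fun p => (snd p + 2 * fst p, snd p)%Z)); [pair_inj| | | |exact Hs].
    - intros [i j] E; cbn [fst snd] in E; apply Z.even_spec in E; destruct E as [k E].
      exists (k, j)%Z; cbn [fst snd]; f_equal; lia.
    - intros [u v]; cbn [fst snd].
      replace (v + 2 * u - v)%Z with (0 + 2 * u)%Z by ring.
      rewrite Z.even_add_mul_2; easy.
    - intros [u v]; unfold K, F, g; cbn [fst snd]; rewrite !theta_term_mul.
      f_equal; f_equal; izr; field. }
  assert (K1 : has_sum (fun z => if Z.odd (fst z - snd z) then K z else 0) s).
  { eapply (has_sum_class K _ _ (fun p => (snd p + 2 * fst p, -1 - snd p)%Z));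
      [pair_inj| | | |exact Hs].
    - intros [i j] E; cbn [fst snd] in E; apply Z.odd_spec in E; destruct E as [k E].
      exists (k + j + 1, -1 - j)%Z; cbn [fst snd]; f_equal; lia.
    - intros [u v]; cbn [fst snd].
      replace (v + 2 * u - (-1 - v))%Z with (1 + 2 * (u + v))%Z by ring.
      rewrite Z.odd_add_mul_2; easy.
    - intros [u v]; unfold K, F, g; cbn [fst snd]; rewrite !theta_term_mul.
      f_equal; f_equal; izr; field. }
  assert (E2 : Th false (1 / 2) t * Th false (1 / 2) (3 * t) = s + s).
  { apply (has_sum_unique K); [apply Th_prod_has_sum; lra|].
    eapply has_sum_ext; [|exact (has_sum_plus _ _ _ _ K0 K1)].
    intros z; cbv beta; rewrite <- Z.negb_odd; destruct (Z.odd (fst z - snd z)); simpl; ring. }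
  assert (E3 : Th false 0 t * Th false 0 (3 * t) - Th true 0 t * Th true 0 (3 * t) = s + s).
  { apply (has_sum_unique (fun p : Z * Z =>
      F p - theta_term true 0 t (fst p) * theta_term true 0 (3 * t) (snd p))).
    - apply has_sum_minus; apply Th_prod_has_sum; lra.
    - eapply has_sum_ext; [|exact (has_sum_plus _ _ _ _ Hodd Hodd)].
      intros [m n]; unfold F; cbn [fst snd]; rewrite !theta_term_mul.
      unfold ch; rewrite Z.odd_add; destruct (Z.odd m), (Z.odd n); simpl; ring. }
  lra.
Qed.

(** * Vanishing and positivity of theta values *)

Lemma Th_true_half t : 0 < t -> Th true (1 / 2) t = 0.
Proof.
  intros Ht; pose proof (Th_reflect true (1 / 2) t Ht) as H.
  replace (1 - 1 / 2) with (1 / 2) in H by field.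
  unfold ch in H; simpl in H; lra.
Qed.

Lemma Th_false_ge_term a t : 0 < t -> exp (- (t * a ^ 2)) <= Th false a t.
Proof.
  intros Ht.
  replace (exp (- (t * a ^ 2))) with (lsum (theta_term false a t) [0%Z]).
  - apply has_sum_ge_finite; [|repeat constructor; easy|now apply Th_has_sum].
    intros n; unfold theta_term, ch; simpl; rewrite Rmult_1_l; left; apply exp_pos.
  - unfold theta_term, ch; simpl; rewrite Rplus_0_l; ring.
Qed.

Lemma Th_false_pos a t : 0 < t -> 0 < Th false a t.
Proof. intros Ht; eapply Rlt_le_trans; [apply exp_pos|now apply Th_false_ge_term]. Qed.

(** Of the two cosets in [Th_mul_2], the odd one carries the vanishing factor [Th true (1 / 2)]. *)
Lemma Th_false_true a t : 0 < t ->
  Th false a t * Th true a t = Th true a (2 * t) * Th true 0 (2 * t).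
Proof.
  intros Ht; rewrite Th_mul_2 by exact Ht; simpl xorb.
  replace ((a + a) / 2) with a by field; replace ((a - a) / 2) with 0 by field.
  replace ((1 + a - a) / 2) with (1 / 2) by field.
  rewrite (Th_true_half (2 * t)) by lra; ring.
Qed.

Lemma is_lim_seq_exp_pow2 c : 0 < c -> is_lim_seq (fun k => exp (- (2 ^ k * c))) 0.
Proof.
  intros Hc.
  apply (is_lim_seq_le_le (fun _ => 0) _ (fun k => exp (- c) ^ k)).
  - intros k; split; [left; apply exp_pos|].
    rewrite exp_pow; apply exp_le_compat.
    assert (INR k <= 2 ^ k); [|nra].
    induction k as [|k IH]; [simpl; lra|].
    rewrite S_INR; simpl pow; pose proof (pow_R1_Rle 2 k ltac:(lra)); lra.
  - apply is_lim_seq_const.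
  - apply is_lim_seq_geom; rewrite Rabs_pos_eq; [|left; apply exp_pos].
    rewrite <- exp_0; apply exp_increasing; lra.
Qed.

(** For such [a], the integer n = 0 is the unique minimum of (n + a)^2, so after division by its own
    term the series tends to 1 along [2 ^ k * t]. *)
Lemma Th_true_eventually_pos a t : 0 < t -> -1 / 2 < a < 1 / 2 ->
  exists N, forall k, (N <= k)%nat -> 0 < Th true a (2 ^ k * t).
Proof.
  intros Ht Ha.
  assert (Hp : forall k, 0 < 2 ^ k * t) by (intros; apply Rmult_lt_0_compat; [apply pow_lt|]; lra).
  assert (Hq : forall n : Z, n <> 0%Z -> 0 < IZR n ^ 2 + 2 * IZR n * a).
  { intros n Hn; destruct (Z_lt_le_dec n 0) as [D|D].
    - assert (IZR n <= -1) by (apply IZR_le; lia); nra.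
    - assert (1 <= IZR n) by (apply IZR_le; lia); nra. }
  set (f := fun k n => exp (2 ^ k * t * a ^ 2) * theta_term true a (2 ^ k * t) n).
  assert (Ef : forall k n, f k n = ch true n * exp (- (2 ^ k * (t * (IZR n ^ 2 + 2 * IZR n * a))))).
  { intros k n; unfold f, theta_term.
    rewrite <- Rmult_assoc, (Rmult_comm (exp _)), Rmult_assoc, <- exp_plus.
    do 2 f_equal; ring. }
  assert (L : is_lim_seq (fun k => exp (2 ^ k * t * a ^ 2) * Th true a (2 ^ k * t)) 1).
  { destruct (theta_term_bounded false a t Ht) as [M HM].
    apply (dominated_convergence f (fun n => if Z.eqb n 0 then 1 else 0)
             (fun n => exp (t * a ^ 2) * theta_term false a t n) (exp (t * a ^ 2) * M)).
    - intros B NB.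
      rewrite (lsum_ext _ (fun n => exp (t * a ^ 2) * Rabs (theta_term false a t n))).
      + rewrite lsum_scal; apply Rmult_le_compat_l; [left; apply exp_pos|auto].
      + intros n; rewrite Rabs_mult, (Rabs_pos_eq (exp _)); [easy|left; apply exp_pos].
    - intros k n; rewrite Ef, Rabs_mult, ch_abs, Rmult_1_l, Rabs_pos_eq by (left; apply exp_pos).
      unfold theta_term, ch; simpl andb; cbv iota; rewrite Rmult_1_l, <- exp_plus.
      apply exp_le_compat.
      assert (0 <= IZR n ^ 2 + 2 * IZR n * a).
      { destruct (Z.eq_dec n 0) as [->|D]; [simpl; lra|left; auto]. }
      pose proof (pow_R1_Rle 2 k ltac:(lra)).
      assert (1 * (t * (IZR n ^ 2 + 2 * IZR n * a)) <= 2 ^ k * (t * (IZR n ^ 2 + 2 * IZR n * a))).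
      { apply Rmult_le_compat_r; [apply Rmult_le_pos|]; lra. }
      lra.
    - intros n; apply (is_lim_seq_ext (fun k => ch true n *
        exp (- (2 ^ k * (t * (IZR n ^ 2 + 2 * IZR n * a)))))); [intros; symmetry; apply Ef|].
      destruct (Z.eqb_spec n 0) as [->|D].
      + apply (is_lim_seq_ext (fun _ => 1)); [|apply is_lim_seq_const].
        intros k; unfold ch; simpl; rewrite <- exp_0 at 1; rewrite Rmult_1_l; f_equal; ring.
      + replace 0 with (ch true n * 0) by ring.
        apply is_lim_seq_mult'; [apply is_lim_seq_const|apply is_lim_seq_exp_pow2].
        apply Rmult_lt_0_compat; auto.
    - intros k; apply has_sum_scal, Th_has_sum, Hp.
    - pose proof (has_sum_finite (fun n => if Z.eqb n 0 then 1 else 0) [0%Z]) as Q.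
      unfold lsum in Q; simpl in Q; rewrite Rplus_0_r in Q.
      apply Q; [repeat constructor; easy|].
      intros n Hn; destruct (Z.eqb_spec n 0) as [->|D]; [exfalso; apply Hn; now left|easy]. }
  apply is_lim_seq_spec in L; destruct (L (mkposreal 1 Rlt_0_1)) as [N HN].
  exists N; intros k Hk; specialize (HN k Hk); cbn [pos] in HN; apply Rabs_def2 in HN.
  apply (Rmult_lt_reg_l (exp (2 ^ k * t * a ^ 2))); [apply exp_pos|lra].
Qed.

(** [Th_false_true] transports positivity from [2 * t] to [t], because the factor [Th false a t] is
    a sum of positive terms. The value at 0 is carried along since it occurs on the right side. *)
Lemma Th_true_pos a t : 0 < t -> -1 / 2 < a < 1 / 2 -> 0 < Th true a t.
Proof.
  intros Ht Ha.
  assert (D : forall k t, 0 < t -> 0 < Th true a (2 ^ k * t) -> 0 < Th true 0 (2 ^ k * t) ->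
    0 < Th true a t /\ 0 < Th true 0 t).
  { induction k as [|k IH]; intros s Hs H1 H2.
    - simpl in *; rewrite Rmult_1_l in *; easy.
    - destruct (IH (2 * s)) as [P1 P2]; [lra| | |].
      + replace (2 ^ k * (2 * s)) with (2 ^ S k * s) by (simpl; ring); exact H1.
      + replace (2 ^ k * (2 * s)) with (2 ^ S k * s) by (simpl; ring); exact H2.
      + split.
        * apply (Rmult_lt_reg_l (Th false a s)); [now apply Th_false_pos|].
          rewrite Rmult_0_r, Th_false_true by exact Hs; now apply Rmult_lt_0_compat.
        * apply (Rmult_lt_reg_l (Th false 0 s)); [now apply Th_false_pos|].
          rewrite Rmult_0_r, Th_false_true by exact Hs; now apply Rmult_lt_0_compat. }
  destruct (Th_true_eventually_pos a t Ht Ha) as [N1 H1].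
  destruct (Th_true_eventually_pos 0 t Ht ltac:(lra)) as [N2 H2].
  apply (D (Nat.max N1 N2) t Ht); [apply H1|apply H2]; lia.
Qed.

(** * Duplication and degree 5 identities for particular characteristics *)

Lemma Th_half_mul a t : 0 < t ->
  Th false (1 / 2) t * Th true a t =
  2 * (Th true ((1 / 2 + a) / 2) (2 * t) * Th true ((1 / 2 - a) / 2) (2 * t)).
Proof.
  intros Ht; rewrite Th_mul_2 by exact Ht; simpl xorb.
  replace ((1 + 1 / 2 + a) / 2) with (1 - (1 / 2 - a) / 2) by field.
  replace ((1 + 1 / 2 - a) / 2) with (1 - (1 / 2 + a) / 2) by field.
  rewrite !Th_reflect by lra; unfold ch; simpl; ring.
Qed.

Lemma theta2_sqr t : 0 < t ->
  Th false (1 / 2) t ^ 2 = 2 * (Th false (1 / 2) (2 * t) * Th false 0 (2 * t)).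
Proof.
  intros Ht; simpl pow; rewrite Rmult_1_r, Th_mul_2 by exact Ht; simpl xorb.
  replace ((1 / 2 + 1 / 2) / 2) with (1 / 2) by field.
  replace ((1 / 2 - 1 / 2) / 2) with 0 by field.
  replace ((1 + 1 / 2 + 1 / 2) / 2) with (0 + 1) by field.
  replace ((1 + 1 / 2 - 1 / 2) / 2) with (1 / 2) by field.
  rewrite Th_succ by lra; unfold ch; simpl; ring.
Qed.

Lemma theta_sqr e t : 0 < t ->
  Th e 0 t ^ 2 = Th false 0 (2 * t) ^ 2 + ch e 1 * Th false (1 / 2) (2 * t) ^ 2.
Proof.
  intros Ht; simpl pow; rewrite !Rmult_1_r, Th_mul_2, Bool.xorb_nilpotent by exact Ht.
  replace ((0 + 0) / 2) with 0 by field; replace ((0 - 0) / 2) with 0 by field.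
  replace ((1 + 0 + 0) / 2) with (1 / 2) by field.
  replace ((1 + 0 - 0) / 2) with (1 / 2) by field; ring.
Qed.

(** With A and B the values of theta_3 and theta_2 at 2t, the squares at t are A^2 + B^2, A^2 - B^2
    and 2 A B, a Pythagorean triple. *)
Lemma jacobi_quartic t : 0 < t ->
  Th false 0 t ^ 4 = Th false (1 / 2) t ^ 4 + Th true 0 t ^ 4.
Proof.
  intros Ht.
  pose proof (theta_sqr false t Ht) as H3; pose proof (theta_sqr true t Ht) as H4.
  pose proof (theta2_sqr t Ht) as H2; unfold ch in *; simpl andb in *; cbv iota in *.
  replace (Th false 0 t ^ 4) with ((Th false 0 t ^ 2) ^ 2) by ring.
  replace (Th false (1 / 2) t ^ 4) with ((Th false (1 / 2) t ^ 2) ^ 2) by ring.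
  replace (Th true 0 t ^ 4) with ((Th true 0 t ^ 2) ^ 2) by ring.
  rewrite H3, H4, H2; ring.
Qed.

(** The four nonzero residues give the same product up to reflections and integer shifts, which
    account for the sign [ch e 1]. *)
Lemma theta_sqr_5 e t : 0 < t ->
  Th e 0 t ^ 2 = Th e 0 (5 * t) ^ 2 + 4 * ch e 1 * (Th e (1 / 5) (5 * t) * Th e (2 / 5) (5 * t)).
Proof.
  intros Ht; simpl pow; rewrite !Rmult_1_r, Th_mul_5 by exact Ht.
  replace ((2 * 0 + 0) / 5) with 0 by field; replace ((2 * 0 - 0) / 5) with 0 by field.
  replace ((3 + 2 * 0 + 0) / 5) with (1 - 2 / 5) by field.
  replace ((1 + 2 * 0 - 0) / 5) with (1 / 5) by field.
  replace ((6 + 2 * 0 + 0) / 5) with (1 / 5 + 1) by field.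
  replace ((2 + 2 * 0 - 0) / 5) with (2 / 5) by field.
  replace ((9 + 2 * 0 + 0) / 5) with ((1 - 1 / 5) + 1) by field.
  replace ((3 + 2 * 0 - 0) / 5) with (1 - 2 / 5) by field.
  replace ((12 + 2 * 0 + 0) / 5) with (2 / 5 + 1 + 1) by field.
  replace ((4 + 2 * 0 - 0) / 5) with (1 - 1 / 5) by field.
  rewrite ?Th_succ, ?Th_reflect by lra.
  unfold ch; destruct e; simpl; ring.
Qed.

Lemma theta2_sqr_5 t : 0 < t ->
  Th false (1 / 2) t ^ 2 =
  Th false (1 / 2) (5 * t) ^ 2 + 4 * (Th false (1 / 10) (5 * t) * Th false (3 / 10) (5 * t)).
Proof.
  intros Ht; simpl pow; rewrite !Rmult_1_r, Th_mul_5 by exact Ht.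
  replace ((2 * (1 / 2) + 1 / 2) / 5) with (3 / 10) by field.
  replace ((2 * (1 / 2) - 1 / 2) / 5) with (1 / 10) by field.
  replace ((3 + 2 * (1 / 2) + 1 / 2) / 5) with (1 - 1 / 10) by field.
  replace ((1 + 2 * (1 / 2) - 1 / 2) / 5) with (3 / 10) by field.
  replace ((6 + 2 * (1 / 2) + 1 / 2) / 5) with (1 / 2 + 1) by field.
  replace ((2 + 2 * (1 / 2) - 1 / 2) / 5) with (1 / 2) by field.
  replace ((9 + 2 * (1 / 2) + 1 / 2) / 5) with (1 / 10 + 1 + 1) by field.
  replace ((3 + 2 * (1 / 2) - 1 / 2) / 5) with (1 - 3 / 10) by field.
  replace ((12 + 2 * (1 / 2) + 1 / 2) / 5) with (1 - 3 / 10 + 1 + 1) by field.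
  replace ((4 + 2 * (1 / 2) - 1 / 2) / 5) with (1 - 1 / 10) by field.
  rewrite ?Th_succ, ?Th_reflect by lra.
  unfold ch; simpl; ring.
Qed.

(** * The quintic relation *)

(* With [A_i] the theta values at [i/10], [u = R(q)] and [v = R(q^2) = A3 / A1], the
   parameter [k = u v^2 = A3 A4 / (A1 A2)] satisfies [(1 - k) / (1 + k) = u^2 / v]. *)
Lemma rr_quintic_algebra A1 A2 A3 A4 Z P1 P3 N1 N3 h x y :
  0 < A1 -> 0 < A2 -> 0 < A3 -> 0 < A4 -> 0 < Z -> 0 < P1 -> 0 < P3 -> 0 < N1 -> 0 < N3 -> 0 < h ->
  P3 * N1 = A2 * A1 + A3 * A4 -> P1 * N3 = A2 * A1 - A3 * A4 ->
  P1 * N1 = A1 * Z -> P3 * N3 = A3 * Z -> h * N3 = 2 * (A4 * A1) -> h * N1 = 2 * (A3 * A2) ->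
  x ^ 2 = Z ^ 2 - 4 * (A2 * A4) -> y ^ 2 = h ^ 2 + 4 * (P1 * P3) ->
  1 / (N3 / N1) ^ 5 - 11 - (N3 / N1) ^ 5 = (x / Z) ^ 4 * (y / h) ^ 2.
Proof.
  intros HA1 HA2 HA3 HA4 HZ HP1 HP3 HN1 HN3 Hh E1 E2 E3 E4 E5 E6 Ex Ey.
  set (u := N3 / N1); set (k := A3 * A4 / (A1 * A2)).
  assert (Hk : 0 < k) by (unfold k; apply Rdiv_lt_0_compat; nra).
  assert (Hk1 : 0 < 1 - k).
  { replace (1 - k) with (P1 * N3 / (A1 * A2)) by (rewrite E2; unfold k; field; lra).
    apply Rdiv_lt_0_compat; nra. }
  assert (Hu : 0 < u) by (unfold u; apply Rdiv_lt_0_compat; lra).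
  assert (Eu : u = A4 * A1 / (A3 * A2)).
  { apply (Rmult_eq_reg_r (h * N1)); [|nra].
    transitivity (h * N3); [unfold u; field; lra|].
    rewrite E5, E6; field; lra. }
  assert (Ek : k = u * (A3 / A1) ^ 2) by (rewrite Eu; unfold k; field; lra).
  assert (Er : (1 - k) * A3 = (1 + k) * (A1 * u ^ 2)).
  { replace (1 - k) with (P1 * N3 / (A1 * A2)) by (rewrite E2; unfold k; field; lra).
    replace (1 + k) with (P3 * N1 / (A1 * A2)) by (rewrite E1; unfold k; field; lra).
    replace P1 with (A1 * Z / N1) by (rewrite <- E3; field; lra).
    replace P3 with (A3 * Z / N3) by (rewrite <- E4; field; lra).
    unfold u; field; lra. }
  (* Ramanujan's parametrization of u^5, obtained by eliminating v. *)
  assert (E5u : u ^ 5 = k * ((1 - k) / (1 + k)) ^ 2).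
  { replace ((1 - k) / (1 + k)) with (A1 * u ^ 2 / A3).
    - rewrite Ek; field; lra.
    - apply (Rmult_eq_reg_r (A3 * (1 + k))); [|nra].
      transitivity ((1 + k) * (A1 * u ^ 2)); [field; lra|].
      rewrite <- Er; field; lra. }
  assert (EK : Z ^ 2 = A1 * A2 ^ 2 / A3 * (1 - k ^ 2)).
  { apply (Rmult_eq_reg_l (A1 * A3)); [|nra].
    transitivity ((P1 * N3) * (P3 * N1)).
    - transitivity ((P1 * N1) * (P3 * N3)); [rewrite E3, E4; ring|ring].
    - rewrite E1, E2; unfold k; field; lra. }
  assert (Hk2 : 0 < 1 - k ^ 2) by nra.
  assert (EA : A2 * A4 = k * (A1 * A2 ^ 2 / A3)) by (unfold k; field; lra).
  set (c := A1 * A2 ^ 2 / A3) in *.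
  assert (Hc : 0 < c) by (unfold c; apply Rdiv_lt_0_compat; [apply Rmult_lt_0_compat; [|apply pow_lt]|]; lra).
  assert (Ex2 : (x / Z) ^ 2 = 1 - 4 * (k / (1 - k ^ 2))).
  { replace ((x / Z) ^ 2) with (x ^ 2 / Z ^ 2) by (field; lra).
    rewrite Ex, EA, EK; clearbody k c; field; lra. }
  assert (Ey2 : (y / h) ^ 2 = 1 + (1 - k ^ 2) / k).
  { replace ((y / h) ^ 2) with (y ^ 2 / h ^ 2) by (field; lra).
    rewrite Ey.
    replace (P1 * P3) with (h ^ 2 * Z ^ 2 / (4 * (A2 * A4))).
    - rewrite EA, EK; clearbody k c; field; lra.
    - apply (Rmult_eq_reg_r (N1 * N3)); [|nra].
      transitivity (A1 * Z * (A3 * Z)); [|rewrite <- E3, <- E4; ring].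
      transitivity ((h * N1) * (h * N3) * Z ^ 2 / (4 * (A2 * A4))); [field; lra|].
      rewrite E5, E6; field; lra. }
  (* In terms of k, both sides are (1 - 4 k - k^2)^2 (1 + k - k^2) / (k (1 - k^2)^2). *)
  replace ((x / Z) ^ 4) with (((x / Z) ^ 2) ^ 2) by ring.
  rewrite Ex2, Ey2, E5u; field; repeat split; nra.
Qed.

(** The quotient [u] will turn out to be R(exp(-4t)), whose nome q^(5/2) is exp(-10t). The six
    product hypotheses of [rr_quintic_algebra] come from the decomposition along 1 + i, the two
    square ones from 2 + i. *)
Lemma rr_quintic t : 0 < t ->
  let u := Th true (3 / 10) (10 * t) / Th true (1 / 10) (10 * t) in
  1 / u ^ 5 - 11 - u ^ 5 =
  (Th false (1 / 2) t / Th false (1 / 2) (5 * t)) ^ 4 *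
  (Th false 0 t / Th false 0 (5 * t)) * (Th true 0 t / Th true 0 (5 * t)).
Proof.
  intros Ht u.
  (* The algebra delivers values at 4t, 2t and at 20t, 10t; duplication brings them back to t and
     5t, and the factor 1/4 cancels in the quotient. *)
  assert (E : forall s, 0 < s -> Th true 0 (4 * s) ^ 4 * Th false (1 / 2) (2 * s) ^ 2 =
     Th false (1 / 2) s ^ 4 * Th false 0 s * Th true 0 s / 4).
  { intros s Hs.
    replace (Th true 0 (4 * s) ^ 4) with ((Th true 0 (4 * s) * Th true 0 (4 * s)) ^ 2) by ring.
    replace (4 * s) with (2 * (2 * s)) by ring.
    rewrite <- (Th_false_true 0 (2 * s)) by lra.
    replace (Th false (1 / 2) s ^ 4 * Th false 0 s * Th true 0 s / 4) with
      ((Th false (1 / 2) s ^ 2) ^ 2 * (Th false 0 s * Th true 0 s) / 4) by field.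
    rewrite (theta2_sqr s Hs), (Th_false_true 0 s Hs); field. }
  pose proof (rr_quintic_algebra (Th true (1 / 10) (20 * t)) (Th true (1 / 5) (20 * t))
    (Th true (3 / 10) (20 * t)) (Th true (2 / 5) (20 * t)) (Th true 0 (20 * t))
    (Th false (1 / 10) (10 * t)) (Th false (3 / 10) (10 * t))
    (Th true (1 / 10) (10 * t)) (Th true (3 / 10) (10 * t)) (Th false (1 / 2) (10 * t))
    (Th true 0 (4 * t)) (Th false (1 / 2) (2 * t))) as Q.
  fold u in Q; rewrite Q; try (apply Th_true_pos; lra); try (apply Th_false_pos; lra).
  - replace ((Th true 0 (4 * t) / Th true 0 (20 * t)) ^ 4 *
      (Th false (1 / 2) (2 * t) / Th false (1 / 2) (10 * t)) ^ 2)
    with ((Th true 0 (4 * t) ^ 4 * Th false (1 / 2) (2 * t) ^ 2) /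
      (Th true 0 (4 * (5 * t)) ^ 4 * Th false (1 / 2) (2 * (5 * t)) ^ 2)).
    + rewrite !E by lra.
      pose proof (Th_false_pos (1 / 2) (5 * t)); pose proof (Th_false_pos 0 (5 * t));
      pose proof (Th_true_pos 0 (5 * t)); field; repeat split; lra.
    + replace (4 * (5 * t)) with (20 * t) by ring; replace (2 * (5 * t)) with (10 * t) by ring.
      pose proof (Th_false_pos (1 / 2) (10 * t)); pose proof (Th_true_pos 0 (20 * t)).
      field; split; lra.
  - rewrite Th_mul_2 by lra; simpl xorb; unfold ch; simpl andb; cbv iota.
    replace ((3 / 10 + 1 / 10) / 2) with (1 / 5) by field.
    replace ((3 / 10 - 1 / 10) / 2) with (1 / 10) by field.
    replace ((1 + 3 / 10 + 1 / 10) / 2) with (1 - 3 / 10) by field.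
    replace ((1 + 3 / 10 - 1 / 10) / 2) with (1 - 2 / 5) by field.
    rewrite !Th_reflect by lra; unfold ch; simpl andb; cbv iota.
    replace (2 * (10 * t)) with (20 * t) by ring; ring.
  - rewrite Th_mul_2 by lra; simpl xorb; unfold ch; simpl andb; cbv iota.
    replace ((1 / 10 + 3 / 10) / 2) with (1 / 5) by field.
    replace ((1 / 10 - 3 / 10) / 2) with (- (1 / 10)) by field.
    replace ((1 + 1 / 10 + 3 / 10) / 2) with (1 - 3 / 10) by field.
    replace ((1 + 1 / 10 - 3 / 10) / 2) with (2 / 5) by field.
    rewrite Th_reflect, Th_opp by lra; unfold ch; simpl andb; cbv iota.
    replace (2 * (10 * t)) with (20 * t) by ring; ring.
  - rewrite Th_false_true by lra; now replace (2 * (10 * t)) with (20 * t) by ring.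
  - rewrite Th_false_true by lra; now replace (2 * (10 * t)) with (20 * t) by ring.
  - rewrite Th_half_mul by lra; replace (2 * (10 * t)) with (20 * t) by ring.
    replace ((1 / 2 + 3 / 10) / 2) with (2 / 5) by field.
    now replace ((1 / 2 - 3 / 10) / 2) with (1 / 10) by field.
  - rewrite Th_half_mul by lra; replace (2 * (10 * t)) with (20 * t) by ring.
    replace ((1 / 2 + 1 / 10) / 2) with (3 / 10) by field.
    now replace ((1 / 2 - 1 / 10) / 2) with (1 / 5) by field.
  - rewrite theta_sqr_5 by lra; unfold ch; simpl andb; cbv iota.
    replace (5 * (4 * t)) with (20 * t) by ring; ring.
  - rewrite theta2_sqr_5 by lra.
    now replace (5 * (2 * t)) with (10 * t) by ring.
Qed.

(** * The inversion formula *)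

(* [bin m k] is the binomial coefficient C(2m, m + k). *)
Fixpoint bin (m : nat) (k : Z) : R :=
  match m with
  | O => if Z.eqb k 0 then 1 else 0
  | S m' => bin m' (k - 1) + 2 * bin m' k + bin m' (k + 1)
  end.

Lemma bin_nonneg m k : 0 <= bin m k.
Proof.
  revert k; induction m as [|m IH]; intros k; simpl.
  - destruct (k =? 0)%Z; lra.
  - pose proof (IH (k - 1)%Z); pose proof (IH k); pose proof (IH (k + 1)%Z); lra.
Qed.

Lemma bin_support m k : (Z.of_nat m < Z.abs k)%Z -> bin m k = 0.
Proof.
  revert k; induction m as [|m IH]; intros k Hk; cbn [bin].
  - destruct (Z.eqb_spec k 0); [lia|easy].
  - rewrite !IH by lia; ring.
Qed.

Lemma bin_opp m k : bin m (- k) = bin m k.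
Proof.
  revert k; induction m as [|m IH]; intros k; cbn [bin].
  - destruct (Z.eqb_spec k 0), (Z.eqb_spec (- k) 0); (lia || easy).
  - replace (- k - 1)%Z with (- (k + 1))%Z by ring; replace (- k + 1)%Z with (- (k - 1))%Z by ring.
    rewrite !IH; ring.
Qed.

Lemma bin_ratio m k : (INR m + IZR k + 1) * bin m (k + 1) = (INR m - IZR k) * bin m k.
Proof.
  revert k; induction m as [|m IH]; intros k.
  - simpl; destruct (Z.eqb_spec k 0) as [->|D]; [simpl; ring|].
    destruct (Z.eqb_spec (k + 1) 0) as [E|D'].
    + replace k with (-1)%Z by lia; simpl; ring.
    + ring.
  - rewrite S_INR; cbn [bin].
    pose proof (IH k) as H0; pose proof (IH (k + 1)%Z) as H1; pose proof (IH (k - 1)%Z) as H2.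
    replace (k - 1 + 1)%Z with k in H2 by ring.
    rewrite plus_IZR in H1; rewrite minus_IZR in H2.
    replace (k + 1 - 1)%Z with k by ring; lra.
Qed.

Lemma bin_0_pos m : 0 < bin m 0.
Proof.
  induction m as [|m IH]; cbn [bin]; [simpl; lra|].
  pose proof (bin_nonneg m (0 - 1)); pose proof (bin_nonneg m (0 + 1)); lra.
Qed.

Lemma one_minus_exp u : 0 <= u < 1 -> exp (- (u / (1 - u))) <= 1 - u <= exp (- u).
Proof.
  intros Hu; split; [|pose proof (exp_ineq1_le (- u)); lra].
  rewrite exp_Ropp; replace (1 - u) with (/ (1 + u / (1 - u))) at 2 by (field; lra).
  assert (0 <= u / (1 - u)) by (apply Rcomplements.Rdiv_le_0_compat; lra).
  apply Rinv_le_contravar; [lra|apply exp_ineq1_le].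
Qed.

(** Consecutive coefficients have ratio 1 - (2j + 1) / (m + j + 1). Replacing the denominators in
    the exponential bounds by [m + k] and [m - k], independent of j, lets the odd numbers 2j + 1 add
    up to a square. *)
Lemma bin_bounds m k j : (k <= m)%nat -> (j <= k)%nat ->
  bin m (Z.of_nat j) <= bin m 0 * exp (- (INR j ^ 2 / (INR m + INR k))) /\
  ((k < m)%nat -> bin m 0 * exp (- (INR j ^ 2 / (INR m - INR k))) <= bin m (Z.of_nat j)).
Proof.
  intros Hk; induction j as [|j IH]; intros Hj.
  - simpl; rewrite !Rmult_0_l; unfold Rdiv; rewrite !Rmult_0_l, Ropp_0, exp_0; split; intros; lra.
  - destruct (IH ltac:(lia)) as [IH1 IH2]; clear IH.
    assert (Hjk : INR j + 1 <= INR k) by (rewrite <- S_INR; now apply le_INR).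
    assert (Hkm : INR k <= INR m) by now apply le_INR.
    pose proof (pos_INR j) as Pj.
    assert (E : bin m (Z.of_nat (S j)) =
      (1 - (2 * INR j + 1) / (INR m + INR j + 1)) * bin m (Z.of_nat j)).
    { pose proof (bin_ratio m (Z.of_nat j)) as H; rewrite <- INR_IZR_INZ in H.
      replace (Z.of_nat (S j)) with (Z.of_nat j + 1)%Z by lia.
      apply (Rmult_eq_reg_l (INR m + INR j + 1)); [|lra].
      rewrite H; field; lra. }
    set (u := (2 * INR j + 1) / (INR m + INR j + 1)) in *.
    assert (Hu : 0 <= u < 1).
    { unfold u; split; [apply Rcomplements.Rdiv_le_0_compat; lra|].
      apply Rcomplements.Rlt_div_l; lra. }
    destruct (one_minus_exp u Hu) as [L U].
    rewrite E, S_INR; split.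
    + apply Rle_trans with (exp (- ((2 * INR j + 1) / (INR m + INR k))) *
        (bin m 0 * exp (- (INR j ^ 2 / (INR m + INR k))))).
      * apply Rmult_le_compat; [lra|apply bin_nonneg| |exact IH1].
        eapply Rle_trans; [exact U|]; apply exp_le_compat, Ropp_le_contravar.
        unfold u; apply Rmult_le_compat_l; [lra|apply Rinv_le_contravar; lra].
      * right; rewrite Rmult_comm, Rmult_assoc, <- exp_plus; do 2 f_equal; field; lra.
    + intros Hlt; specialize (IH2 Hlt).
      assert (Hlt' : INR k < INR m) by now apply lt_INR.
      apply Rle_trans with (exp (- ((2 * INR j + 1) / (INR m - INR k))) *
        (bin m 0 * exp (- (INR j ^ 2 / (INR m - INR k))))).
      * right; symmetry; rewrite Rmult_comm, Rmult_assoc, <- exp_plus; do 2 f_equal; field; lra.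
      * apply Rmult_le_compat; [left; apply exp_pos| | |exact IH2].
        { apply Rmult_le_pos; [left; apply bin_0_pos|left; apply exp_pos]. }
        eapply Rle_trans; [|exact L]; apply exp_le_compat, Ropp_le_contravar.
        replace (u / (1 - u)) with ((2 * INR j + 1) / (INR m - INR j)) by (unfold u; field; lra).
        apply Rmult_le_compat_l; [lra|apply Rinv_le_contravar; lra].
Qed.

Lemma has_sum_shift (f : Z -> R) s c : has_sum f s -> has_sum (fun k => f (k + c)%Z) s.
Proof.
  intros H; apply (has_sum_inj _ (fun k => (k - c)%Z)); [lia| |].
  - intros x _; exists (x + c)%Z; lia.
  - eapply has_sum_ext; [|exact H]; intros k; f_equal; lia.
Qed.

(** The binomial expansion of (e^(ix) + e^(-ix))^(2m) in real form. The free phase [phi] closes the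
    induction: the shifts k - 1 and k + 1 in [bin] are absorbed by changing it by 2x. *)
Lemma bin_cos_sum m x phi :
  has_sum (fun k => bin m k * cos (2 * IZR k * x + phi)) ((2 * cos x) ^ (2 * m) * cos phi).
Proof.
  revert phi; induction m as [|m IH]; intros phi.
  - pose proof (has_sum_finite (fun k => bin 0 k * cos (2 * IZR k * x + phi)) [0%Z]) as Q.
    unfold lsum in Q; simpl in Q.
    replace ((2 * cos x) ^ (2 * 0) * cos phi) with (1 * cos (2 * 0 * x + phi) + 0).
    + apply Q; [repeat constructor; easy|].
      intros k Hk; destruct (Z.eqb_spec k 0) as [->|D]; [exfalso; apply Hk; now left|ring].
    + simpl; rewrite Rmult_0_r, Rmult_0_l, Rplus_0_l; ring.
  - pose proof (has_sum_shift _ _ (-1) (IH (phi + 2 * x))) as H1.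
    pose proof (has_sum_shift _ _ 1 (IH (phi - 2 * x))) as H2.
    pose proof (has_sum_plus _ _ _ _ (has_sum_plus _ _ _ _ H1 (has_sum_scal 2 _ _ (IH phi))) H2) as H.
    replace ((2 * cos x) ^ (2 * S m) * cos phi) with
      ((2 * cos x) ^ (2 * m) * cos (phi + 2 * x) + 2 * ((2 * cos x) ^ (2 * m) * cos phi) +
       (2 * cos x) ^ (2 * m) * cos (phi - 2 * x)).
    + eapply has_sum_ext; [|exact H].
      intros k; cbn [bin]; rewrite !plus_IZR.
      replace (2 * (IZR k + -1) * x + (phi + 2 * x)) with (2 * IZR k * x + phi) by ring.
      replace (2 * (IZR k + 1) * x + (phi - 2 * x)) with (2 * IZR k * x + phi) by ring.
      replace (k + -1)%Z with (k - 1)%Z by ring; ring.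
    + replace (2 * S m)%nat with (2 + 2 * m)%nat by lia.
      rewrite pow_add, cos_plus, cos_minus, cos_2a_cos; ring.
Qed.

(** * Cosine sums over equidistant points *)

Lemma has_sum_lsum {T U} (f : U -> T -> R) (s : U -> R) L :
  (forall j, has_sum (f j) (s j)) -> has_sum (fun x => lsum (fun j => f j x) L) (lsum s L).
Proof.
  intros H; induction L as [|j L IH]; simpl.
  - pose proof (has_sum_finite (fun _ : T => 0) []) as Q; apply Q; [constructor|easy].
  - now apply has_sum_plus.
Qed.

Lemma lsum_cos_interval x y p :
  2 * sin x * lsum (fun j => cos (2 * x * IZR j + y)) (interval p) =
  2 * sin ((2 * INR p + 1) * x) * cos y.
Proof.
  induction p as [|p IH].
  - unfold lsum; simpl; rewrite !Rmult_0_r, !Rplus_0_l, Rplus_0_r, Rmult_1_l; ring.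
  - cbn [interval lsum fold_right].
    fold (lsum (fun j => cos (2 * x * IZR j + y)) (interval p)).
    rewrite opp_IZR, <- INR_IZR_INZ.
    rewrite !Rmult_plus_distr_l, IH, S_INR.
    replace (2 * x * - (INR p + 1) + y) with (y - 2 * x * (INR p + 1)) by ring.
    rewrite (cos_plus _ y), (cos_minus y).
    set (w := 2 * x * (INR p + 1)).
    replace ((2 * INR p + 1) * x) with (w - x) by (unfold w; ring).
    replace ((2 * (INR p + 1) + 1) * x) with (w + x) by (unfold w; ring).
    rewrite sin_plus, sin_minus; ring.
Qed.

(** The shift of the sample points that is Fourier dual to the character [ch e]; this is why
    inversion turns theta_4 into theta_2. *)
Definition half (e : bool) : R := if e then 1 / 2 else 0.

Lemma cos_sin_IZR_PI n : cos (IZR n * PI) = ch true n /\ sin (IZR n * PI) = 0.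
Proof.
  assert (H : forall k, cos (INR k * PI) = ch true (Z.of_nat k) /\ sin (INR k * PI) = 0).
  { induction k as [|k [H1 H2]].
    - simpl; rewrite Rmult_0_l, cos_0, sin_0; easy.
    - rewrite S_INR, Rmult_plus_distr_r, Rmult_1_l, neg_cos, neg_sin, H1, H2.
      split; [|ring]. unfold ch; rewrite Nat2Z.inj_succ, Z.odd_succ, <- Z.negb_odd.
      destruct (Z.odd (Z.of_nat k)); simpl; ring. }
  destruct (Z_le_gt_dec 0 n) as [D|D].
  - rewrite <- (Z2Nat.id n D), <- INR_IZR_INZ; apply H.
  - destruct (H (Z.to_nat (- n))) as [H1 H2].
    rewrite INR_IZR_INZ, Z2Nat.id, opp_IZR, Ropp_mult_distr_l_reverse in H1, H2 by lia.
    rewrite cos_neg in H1; rewrite sin_neg in H2.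
    unfold ch in *; rewrite Z.odd_opp in H1; split; [exact H1|lra].
Qed.

Lemma cos_half e n : cos (2 * IZR n * (PI * half e)) = ch e n.
Proof.
  destruct e; unfold half.
  - replace (2 * IZR n * (PI * (1 / 2))) with (IZR n * PI) by field; apply cos_sin_IZR_PI.
  - rewrite !Rmult_0_r, cos_0; easy.
Qed.

(** The number of points in [interval p], which is thus a full residue system modulo it. *)
Definition odd_nat (p : nat) : Z := (2 * Z.of_nat p + 1)%Z.

Lemma lsum_cos_roots e p k : let l := odd_nat p in
  lsum (fun j => cos (2 * IZR k * (PI * (IZR j + half e) / IZR l))) (interval p) =
  if (k mod l =? 0)%Z then IZR l * ch e (k / l) else 0.
Proof.
  intros l.
  assert (Hl : (0 < l)%Z) by (unfold l, odd_nat; lia).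
  assert (Hl' : 0 < IZR l) by now apply IZR_lt.
  assert (El : IZR l = 2 * INR p + 1).
  { unfold l, odd_nat; rewrite plus_IZR, mult_IZR, <- INR_IZR_INZ; easy. }
  set (x := IZR k * PI / IZR l).
  rewrite (lsum_ext _ (fun j => cos (2 * x * IZR j + 2 * x * half e))).
  2:{ intros j; f_equal; unfold x; field; lra. }
  destruct (Z.eqb_spec (k mod l) 0) as [E|D].
  - assert (Ek : k = (l * (k / l))%Z).
    { pose proof (Z_div_mod_eq_full k l); lia. }
    set (n := (k / l)%Z) in *.
    assert (Ex : x = IZR n * PI) by (unfold x; rewrite Ek, mult_IZR; field; lra).
    rewrite (lsum_ext _ (fun j => ch e n * 1)).
    + rewrite lsum_scal, Rmult_comm; f_equal.
      clear; unfold l, odd_nat; induction p as [|p IH]; [unfold lsum; simpl; ring|].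
      cbn [interval lsum fold_right]; fold (lsum (fun _ : Z => 1) (interval p)); rewrite IH.
      rewrite !plus_IZR, !mult_IZR, <- !INR_IZR_INZ, S_INR; ring.
    + intros j; rewrite Ex.
      replace (2 * (IZR n * PI) * IZR j) with (IZR (2 * (n * j)) * PI) by (rewrite !mult_IZR; ring).
      destruct (cos_sin_IZR_PI (2 * (n * j))) as [C S].
      rewrite cos_plus, C, S.
      replace (2 * (IZR n * PI) * half e) with (2 * IZR n * (PI * half e)) by ring.
      rewrite cos_half; unfold ch at 1; rewrite Z.odd_mul; simpl; ring.
  - pose proof (lsum_cos_interval x (2 * x * half e) p) as H.
    rewrite <- El in H.
    replace (IZR l * x) with (IZR k * PI) in H by (unfold x; field; lra).
    destruct (cos_sin_IZR_PI k) as [_ S]; rewrite S in H.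
    apply (Rmult_eq_reg_l (2 * sin x)); [rewrite H; ring|].
    intros Z0; apply D.
    destruct (sin_eq_0_0 x) as [n Hn]; [lra|].
    assert (Ekn : IZR k = IZR (n * l)).
    { rewrite mult_IZR; apply (Rmult_eq_reg_r (PI / IZR l)).
      - transitivity x; [unfold x; field; lra|].
        rewrite Hn; field; lra.
      - pose proof PI_RGT_0; apply Rgt_not_eq, Rdiv_lt_0_compat; lra. }
    apply eq_IZR in Ekn; rewrite Ekn; apply Z_mod_mult.
Qed.

(* The finite form of the inversion formula: the binomial expansion of
   (2 cos x)^(2m) summed over equidistant points. *)
Lemma bin_roots e p m : let l := odd_nat p in
  has_sum (fun n => ch e n * (bin m (l * n) / bin m 0))
    (2 ^ (2 * m) / (IZR l * bin m 0) *
     lsum (fun j => cos (PI * (IZR j + half e) / IZR l) ^ (2 * m)) (interval p)).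
Proof.
  intros l.
  assert (Hl : (0 < l)%Z) by (unfold l, odd_nat; lia).
  assert (Hl' : 0 < IZR l) by now apply IZR_lt.
  pose proof (bin_0_pos m) as Hb.
  set (g := fun n => ch e n * (bin m (l * n) / bin m 0)).
  assert (Hg : has_sum g (lsum g (interval m))).
  { apply has_sum_finite; [apply interval_NoDup|].
    intros n Hn; rewrite interval_spec in Hn; unfold g; rewrite bin_support; [field; lra|].
    rewrite Z.abs_mul; nia. }
  (* One double sum in two orders: summing over the points first keeps only the multiples of [l],
     summing over k first gives powers of cosines. *)
  set (f := fun k => bin m k *
    lsum (fun j => cos (2 * IZR k * (PI * (IZR j + half e) / IZR l))) (interval p)).
  assert (Hf1 : has_sum f (IZR l * bin m 0 * lsum g (interval m))).
  { apply (has_sum_inj f (fun n => (l * n)%Z)); [intros; nia| |].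
    - intros k Hk; unfold f in Hk; unfold l in Hk; rewrite lsum_cos_roots in Hk; fold l in Hk.
      destruct (Z.eqb_spec (k mod l) 0) as [E|D]; [|exfalso; apply Hk; ring].
      exists (k / l)%Z; pose proof (Z_div_mod_eq_full k l); lia.
    - eapply has_sum_ext; [|apply has_sum_scal, Hg].
      intros n; unfold f, g; unfold l at 5; rewrite lsum_cos_roots; fold l.
      rewrite Z.mul_comm, Z_mod_mult, Z.eqb_refl, Z_div_mult by lia; field; lra. }
  assert (Hf2 : has_sum f (2 ^ (2 * m) *
    lsum (fun j => cos (PI * (IZR j + half e) / IZR l) ^ (2 * m)) (interval p))).
  { rewrite <- lsum_scal.
    eapply has_sum_ext; [|apply (has_sum_lsum (fun j k => bin m k *
      cos (2 * IZR k * (PI * (IZR j + half e) / IZR l) + 0)))].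
    - intros k; cbv beta; rewrite lsum_scal; unfold f; f_equal; apply lsum_ext; intros j.
      now rewrite Rplus_0_r.
    - intros j; rewrite <- Rpow_mult_distr.
      pose proof (bin_cos_sum m (PI * (IZR j + half e) / IZR l) 0) as Q.
      now rewrite cos_0, Rmult_1_r in Q. }
  pose proof (has_sum_unique _ _ _ Hf1 Hf2) as E.
  replace (2 ^ (2 * m) / (IZR l * bin m 0) * _) with (lsum g (interval m)); [exact Hg|].
  apply (Rmult_eq_reg_l (IZR l * bin m 0)); [|apply Rgt_not_eq, Rmult_lt_0_compat; lra].
  rewrite E; field; lra.
Qed.

(** * The scaling limit *)

Definition mesh (p : nat) : R := / IZR (odd_nat p).

(** With m close to s l^2, where l is [odd_nat p], the quotient [bin m (l * n) / bin m 0] tends to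
    exp(-n^2 / s) and cos(c / l)^(2m) to exp(-s c^2). Rounding up guarantees m >= s l^2. *)
Definition steps (s : R) (p : nat) : nat := Z.to_nat (up (s * IZR (odd_nat p) ^ 2)).

Lemma odd_nat_ge1 p : 1 <= IZR (odd_nat p).
Proof. apply IZR_le; unfold odd_nat; lia. Qed.

Lemma odd_nat_INR p : IZR (odd_nat p) = 2 * INR p + 1.
Proof. unfold odd_nat; rewrite plus_IZR, mult_IZR, <- INR_IZR_INZ; easy. Qed.

Lemma mesh_bounds p : 0 < mesh p <= 1.
Proof.
  pose proof (odd_nat_ge1 p); unfold mesh; split; [apply Rinv_0_lt_compat; lra|].
  rewrite <- Rinv_1; apply Rinv_le_contravar; lra.
Qed.

Lemma mesh_lim : is_lim_seq mesh 0.
Proof.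
  apply (is_lim_seq_le_le (fun _ => 0) _ (fun p => / (INR p + 1))).
  - intros p; split; [left; apply mesh_bounds|].
    pose proof (pos_INR p); unfold mesh; rewrite odd_nat_INR; apply Rinv_le_contravar; lra.
  - apply is_lim_seq_const.
  - replace (Finite 0) with (Rbar_inv p_infty) by easy.
    apply is_lim_seq_inv; [|easy].
    apply (is_lim_seq_ext (fun p => INR (S p))); [intros; apply S_INR|].
    apply -> is_lim_seq_incr_1; apply is_lim_seq_INR.
Qed.

Lemma mesh_lim_continuous (f : R -> R) (l : R) : ex_derive f 0 -> f 0 = l ->
  is_lim_seq (fun p => f (mesh p)) l.
Proof.
  intros H <-; apply (is_lim_seq_continuous f mesh 0); [|exact mesh_lim].
  apply continuity_pt_filterlim, (ex_derive_continuous f), H.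
Qed.

Lemma steps_bounds s p : 0 < s -> s <= INR (steps s p) * mesh p ^ 2 <= s + mesh p ^ 2.
Proof.
  intros Hs; pose proof (odd_nat_ge1 p) as Hl; unfold steps, mesh.
  set (l := IZR (odd_nat p)) in *.
  destruct (archimed (s * l ^ 2)) as [A1 A2].
  assert (P : 0 < s * l ^ 2) by (apply Rmult_lt_0_compat; [lra|apply pow_lt; lra]).
  rewrite INR_IZR_INZ, Z2Nat.id by (apply le_IZR; lra).
  set (M := IZR (up (s * l ^ 2))) in *.
  assert (Hi : 0 < (/ l) ^ 2) by (apply pow_lt, Rinv_0_lt_compat; lra).
  assert (Es : s * l ^ 2 * (/ l) ^ 2 = s) by (field; lra).
  split.
  - rewrite <- Es at 1; apply Rmult_le_compat_r; lra.
  - rewrite <- Es at 1; rewrite <- (Rmult_1_l ((/ l) ^ 2)) at 3.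
    rewrite <- Rmult_plus_distr_r; apply Rmult_le_compat_r; lra.
Qed.

Lemma steps_lim s : 0 < s -> is_lim_seq (fun p => INR (steps s p) * mesh p ^ 2) s.
Proof.
  intros Hs; apply (is_lim_seq_le_le (fun _ => s) _ (fun p => s + mesh p ^ 2)).
  - intros p; now apply steps_bounds.
  - apply is_lim_seq_const.
  - apply (mesh_lim_continuous (fun x => s + x ^ 2)); [auto_derive; easy|ring].
Qed.

Lemma is_lim_seq_exp u (l : R) : is_lim_seq u l -> is_lim_seq (fun n => exp (u n)) (exp l).
Proof.
  apply (is_lim_seq_continuous exp); apply derivable_continuous_pt, derivable_pt_exp.
Qed.

Lemma sin_mesh_lim c : is_lim_seq (fun p => sin (c * mesh p) / mesh p) c.
Proof.
  destruct (Req_dec c 0) as [->|Hc].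
  - apply (is_lim_seq_ext (fun _ => 0)); [|apply is_lim_seq_const].
    intros p; rewrite Rmult_0_l, sin_0; unfold Rdiv; ring.
  - apply (is_lim_seq_ext (fun p => c * (sin (c * mesh p) / (c * mesh p)))).
    + intros p; pose proof (mesh_bounds p); field; lra.
    + replace (Finite c) with (Finite (c * 1)) by (f_equal; ring).
      apply is_lim_seq_mult'; [apply is_lim_seq_const|].
      apply (is_lim_comp_seq (fun x => sin x / x) (fun p => c * mesh p) 0 1).
      * apply is_lim_sinc_0.
      * exists O; intros n _ H; injection H; intros H'.
        pose proof (mesh_bounds n); apply Rmult_integral in H'; lra.
      * replace (Finite 0) with (Finite (c * 0)) by (f_equal; ring).
        apply is_lim_seq_mult'; [apply is_lim_seq_const|apply mesh_lim].
Qed.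

Lemma pow_exp_bounds u m : 0 <= u < 1 ->
  exp (- (INR m * u / (1 - u))) <= (1 - u) ^ m <= exp (- (INR m * u)).
Proof.
  intros Hu; destruct (one_minus_exp u Hu) as [L U].
  replace (- (INR m * u / (1 - u))) with (INR m * - (u / (1 - u))) by (field; lra).
  replace (- (INR m * u)) with (INR m * - u) by ring.
  rewrite <- !exp_pow; split; apply pow_incr; split; try lra; left; apply exp_pos.
Qed.

Lemma cos_pow_sin x m : cos x ^ (2 * m) = (1 - sin x ^ 2) ^ m.
Proof.
  rewrite pow_mult; f_equal; pose proof (sin2_cos2 x) as H; unfold Rsqr in H; lra.
Qed.

(** Squeezes (1 - sin^2)^m between exponentials, using that m sin^2(c mesh) tends to s c^2. *)
Lemma cos_pow_lim s c : 0 < s ->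
  is_lim_seq (fun p => cos (c * mesh p) ^ (2 * steps s p)) (exp (- (s * c ^ 2))).
Proof.
  intros Hs.
  set (u := fun p => sin (c * mesh p) ^ 2).
  assert (Hu : is_lim_seq u 0).
  { apply (mesh_lim_continuous (fun x => sin (c * x) ^ 2)); [auto_derive; easy|].
    rewrite Rmult_0_r, sin_0; ring. }
  assert (Hmu : is_lim_seq (fun p => INR (steps s p) * u p) (s * c ^ 2)).
  { apply (is_lim_seq_ext (fun p => INR (steps s p) * mesh p ^ 2 *
      (sin (c * mesh p) / mesh p * (sin (c * mesh p) / mesh p)))).
    - intros p; pose proof (mesh_bounds p); unfold u; field; lra.
    - replace (c ^ 2) with (c * c) by ring.
      apply is_lim_seq_mult'; [now apply steps_lim|].
      apply is_lim_seq_mult'; apply sin_mesh_lim. }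
  apply (is_lim_seq_le_le_loc (fun p => exp (- (INR (steps s p) * u p / (1 - u p)))) _
    (fun p => exp (- (INR (steps s p) * u p)))).
  - apply is_lim_seq_spec in Hu; destruct (Hu (mkposreal 1 Rlt_0_1)) as [N HN].
    exists N; intros n Hn; specialize (HN n Hn); cbn [pos] in HN; apply Rabs_def2 in HN.
    rewrite cos_pow_sin; apply pow_exp_bounds; split; [unfold u; apply pow2_ge_0|lra].
  - apply is_lim_seq_exp.
    replace (Finite (- (s * c ^ 2))) with (Rbar_opp (s * c ^ 2 / (1 - 0))) by (simpl; f_equal; field).
    apply -> is_lim_seq_opp.
    apply is_lim_seq_div'; [exact Hmu| |lra].
    apply is_lim_seq_minus'; [apply is_lim_seq_const|exact Hu].
  - apply is_lim_seq_exp.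
    change (Finite (- (s * c ^ 2))) with (Rbar_opp (s * c ^ 2)).
    now apply -> is_lim_seq_opp.
Qed.

(** From sin x >= x - x^3 / 6 and x^2 <= 4. The interval contains PI / 2, as PI <= 4; a linear bound
    is all that Gaussian domination asks for. *)
Lemma sin_lower x : 0 <= x <= 2 -> x / 3 <= sin x.
Proof.
  intros Hx; destruct (pre_sin_bound x 0) as [H _]; [lra|lra|].
  unfold sin_approx, sin_term in H; simpl in H.
  assert (x ^ 2 <= 4) by nra.
  assert (x * (x ^ 2) <= x * 4) by (apply Rmult_le_compat_l; lra).
  lra.
Qed.

Lemma cos_pow_le s p c : 0 < s -> Rabs (c * mesh p) <= PI / 2 ->
  0 <= cos (c * mesh p) ^ (2 * steps s p) <= exp (- (s * c ^ 2 / 9)).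
Proof.
  intros Hs Hx; pose proof PI_4 as P4; pose proof (mesh_bounds p) as Hm.
  set (x := c * mesh p) in *.
  rewrite cos_pow_sin.
  assert (Hsin : (x ^ 2 / 9 <= sin x ^ 2)).
  { assert (E : sin x ^ 2 = sin (Rabs x) ^ 2).
    { unfold Rabs; destruct Rcase_abs; [rewrite sin_neg; ring|easy]. }
    rewrite E; pose proof (sin_lower (Rabs x)) as L; pose proof (Rabs_pos x).
    specialize (L ltac:(lra)).
    rewrite <- (pow2_abs x); nra. }
  assert (H1 : 0 <= 1 - sin x ^ 2).
  { pose proof (SIN_bound x); nra. }
  split; [now apply pow_le|].
  apply Rle_trans with (exp (- sin x ^ 2) ^ steps s p).
  - apply pow_incr; split; [exact H1|pose proof (exp_ineq1_le (- sin x ^ 2)); lra].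
  - rewrite exp_pow; apply exp_le_compat.
    destruct (steps_bounds s p Hs) as [L _].
    pose proof (pos_INR (steps s p)) as PN.
    assert (INR (steps s p) * (x ^ 2 / 9) <= INR (steps s p) * sin x ^ 2)
      by (apply Rmult_le_compat_l; assumption).
    assert (s * c ^ 2 <= INR (steps s p) * mesh p ^ 2 * c ^ 2)
      by (apply Rmult_le_compat_r; [apply pow2_ge_0|exact L]).
    unfold x in *; lra.
Qed.

(** The first and last bounds squeeze the pointwise limit; the middle one is uniform in [p] and
    serves as the dominating function. *)
Lemma bin_steps_nat s p n : 0 < s ->
  let b := bin (steps s p) (odd_nat p * Z.of_nat n) / bin (steps s p) 0 in
  0 <= b <= exp (- (INR n ^ 2 / (s + mesh p ^ 2 + INR n * mesh p))) /\
  b <= exp (- (1 / (2 * (s + 1)) * INR n ^ 2)) /\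
  (INR n * mesh p < s -> exp (- (INR n ^ 2 / (s - INR n * mesh p))) <= b).
Proof.
  intros Hs b.
  destruct (steps_bounds s p Hs) as [L U].
  pose proof (mesh_bounds p) as Hm; pose proof (odd_nat_ge1 p) as Hl; pose proof (pos_INR n) as Pn.
  set (m := steps s p) in *.
  pose proof (bin_0_pos m) as Hb; pose proof (pos_INR m) as Pm.
  assert (Em : mesh p * IZR (odd_nat p) = 1) by (unfold mesh; field; lra).
  set (k := (Z.to_nat (odd_nat p) * n)%nat).
  assert (Ek : (odd_nat p * Z.of_nat n)%Z = Z.of_nat k).
  { unfold k, odd_nat; lia. }
  assert (EkR : INR k = IZR (odd_nat p) * INR n).
  { rewrite !INR_IZR_INZ, <- mult_IZR, Ek; easy. }
  assert (Ekm : INR k * mesh p = INR n) by (rewrite EkR; nra).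
  assert (Hm2 : 0 < mesh p ^ 2) by (apply pow_lt; lra).
  assert (Hm1 : mesh p ^ 2 <= 1) by nra.
  assert (Hmpos : 0 < INR m * mesh p ^ 2) by lra.
  assert (Hmp : 0 < INR m) by nra.
  pose proof (pos_INR k) as Pk.
  assert (E2 : forall y, y <> 0 -> INR k ^ 2 / y = INR n ^ 2 / (y * mesh p ^ 2)).
  { intros y Hy; rewrite <- Ekm; field; lra. }
  assert (Ey : forall y, (INR m + y * INR k) * mesh p ^ 2 = INR m * mesh p ^ 2 + y * INR n * mesh p).
  { intros y; rewrite <- Ekm; ring. }
  unfold b; rewrite Ek; clear b.
  assert (B0 : 0 <= bin m (Z.of_nat k) / bin m 0).
  { apply Rcomplements.Rdiv_le_0_compat; [apply bin_nonneg|exact Hb]. }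
  destruct (le_lt_dec k m) as [D|D].
  - destruct (bin_bounds m k k D (le_n k)) as [UB LB].
    assert (UB' : bin m (Z.of_nat k) / bin m 0 <= exp (- (INR k ^ 2 / (INR m + INR k)))).
    { apply Rcomplements.Rle_div_l; [exact Hb|lra]. }
    assert (Dk : INR k <= INR m) by now apply le_INR.
    split; [split; [exact B0|]|split].
    + eapply Rle_trans; [exact UB'|]; apply exp_le_compat, Ropp_le_contravar.
      rewrite E2 by lra.
      pose proof (Ey 1) as E1; rewrite !Rmult_1_l in E1; rewrite E1.
      apply Rmult_le_compat_l; [apply pow2_ge_0|].
      apply Rinv_le_contravar; [nra|lra].
    + eapply Rle_trans; [exact UB'|]; apply exp_le_compat, Ropp_le_contravar.
      rewrite E2 by lra.
      pose proof (Ey 1) as E1; rewrite !Rmult_1_l in E1.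
      assert ((INR m + INR k) * mesh p ^ 2 <= 2 * (s + 1)).
      { apply Rle_trans with (2 * (INR m * mesh p ^ 2)); [nra|lra]. }
      unfold Rdiv; rewrite Rmult_1_l, Rmult_comm.
      apply Rmult_le_compat_l; [apply pow2_ge_0|].
      apply Rinv_le_contravar; [nra|lra].
    + intros Hlt.
      assert (Dk' : INR k < INR m).
      { apply (Rmult_lt_reg_r (mesh p ^ 2)); [exact Hm2|].
        replace (INR k * mesh p ^ 2) with (INR n * mesh p) by (rewrite <- Ekm; ring); lra. }
      specialize (LB (INR_lt _ _ Dk')).
      assert (LB' : exp (- (INR k ^ 2 / (INR m - INR k))) <= bin m (Z.of_nat k) / bin m 0).
      { apply Rcomplements.Rle_div_r; [exact Hb|lra]. }
      eapply Rle_trans; [|exact LB']; apply exp_le_compat, Ropp_le_contravar.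
      rewrite E2 by lra.
      pose proof (Ey (-1)) as E1.
      replace ((INR m - INR k) * mesh p ^ 2) with (INR m * mesh p ^ 2 - INR n * mesh p) by lra.
      apply Rmult_le_compat_l; [apply pow2_ge_0|].
      apply Rinv_le_contravar; lra.
  - rewrite bin_support by lia.
    unfold Rdiv at 2 3 4; rewrite Rmult_0_l.
    repeat split; try lra; try (left; apply exp_pos).
    intros Hlt; exfalso.
    apply lt_INR in D.
    assert (INR m * mesh p ^ 2 < INR k * mesh p ^ 2) by (apply Rmult_lt_compat_r; lra).
    replace (INR k * mesh p ^ 2) with (INR n * mesh p) in * by (rewrite <- Ekm; ring).
    lra.
Qed.

Lemma bin_steps_abs s p n :
  bin (steps s p) (odd_nat p * n) = bin (steps s p) (odd_nat p * Z.of_nat (Z.abs_nat n)).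
Proof.
  destruct (Z_le_gt_dec 0 n) as [D|D].
  - now replace (Z.of_nat (Z.abs_nat n)) with n by lia.
  - replace (odd_nat p * Z.of_nat (Z.abs_nat n))%Z with (- (odd_nat p * n))%Z by lia.
    now rewrite bin_opp.
Qed.

Lemma bin_steps_lim s n : 0 < s ->
  is_lim_seq (fun p => bin (steps s p) (odd_nat p * n) / bin (steps s p) 0)
    (exp (- (1 / s * (IZR n + 0) ^ 2))).
Proof.
  intros Hs; set (k := Z.abs_nat n).
  replace (1 / s * (IZR n + 0) ^ 2) with (INR k ^ 2 / s).
  2:{ unfold k; rewrite INR_Zabs_nat, pow2_abs; field; lra. }
  apply (is_lim_seq_ext (fun p => bin (steps s p) (odd_nat p * Z.of_nat k) / bin (steps s p) 0)).
  { intros p; now rewrite (bin_steps_abs s p n). }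
  apply (is_lim_seq_le_le_loc (fun p => exp (- (INR k ^ 2 / (s - INR k * mesh p)))) _
    (fun p => exp (- (INR k ^ 2 / (s + mesh p ^ 2 + INR k * mesh p))))).
  - assert (H : is_lim_seq (fun p => INR k * mesh p) 0).
    { apply (mesh_lim_continuous (fun x => INR k * x)); [auto_derive; easy|ring]. }
    apply is_lim_seq_spec in H; destruct (H (mkposreal s Hs)) as [N HN].
    exists N; intros p Hp; specialize (HN p Hp); cbn [pos] in HN; apply Rabs_def2 in HN.
    destruct (bin_steps_nat s p k Hs) as [[_ U] [_ L]]; split; [apply L; lra|exact U].
  - apply (mesh_lim_continuous (fun x => exp (- (INR k ^ 2 / (s - INR k * x))))).
    + auto_derive; lra.
    + do 3 f_equal; ring.
  - apply (mesh_lim_continuous (fun x => exp (- (INR k ^ 2 / (s + x ^ 2 + INR k * x))))).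
    + auto_derive; lra.
    + do 3 f_equal; ring.
Qed.

Lemma theta_binomial_limit e s (L : nat -> R) : 0 < s ->
  (forall p, has_sum (fun n => ch e n * (bin (steps s p) (odd_nat p * n) / bin (steps s p) 0)) (L p)) ->
  is_lim_seq L (Th e 0 (1 / s)).
Proof.
  intros Hs HL.
  destruct (theta_term_bounded false 0 (1 / (2 * (s + 1)))) as [M HM].
  { apply Rdiv_lt_0_compat; lra. }
  refine (dominated_convergence _ (theta_term e 0 (1 / s)) _ M L _ HM _ _ HL _).
  - intros p n; rewrite Rabs_mult, ch_abs, Rmult_1_l, bin_steps_abs.
    destruct (bin_steps_nat s p (Z.abs_nat n) Hs) as [[B _] [U _]].
    rewrite Rabs_pos_eq by exact B; unfold theta_term, ch; simpl andb; cbv iota.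
    rewrite Rmult_1_l, Rplus_0_r; rewrite INR_Zabs_nat, pow2_abs in U; exact U.
  - intros n; unfold theta_term.
    apply is_lim_seq_mult'; [apply is_lim_seq_const|now apply bin_steps_lim].
  - apply Th_has_sum, Rdiv_lt_0_compat; lra.
Qed.

Lemma theta_cosine_limit e s : 0 < s ->
  is_lim_seq (fun p => lsum (fun j => cos (PI * (IZR j + half e) / IZR (odd_nat p)) ^ (2 * steps s p))
    (interval p)) (Th false (half e) (PI ^ 2 * s)).
Proof.
  intros Hs; pose proof PI_RGT_0 as HP.
  assert (Hk : 0 < PI ^ 2 * s) by (apply Rmult_lt_0_compat; [apply pow_lt|]; lra).
  destruct (theta_term_bounded false (half e) (PI ^ 2 * s / 9)) as [M HM]; [lra|].
  assert (Ec : forall p j, PI * (IZR j + half e) / IZR (odd_nat p) = PI * (IZR j + half e) * mesh p)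
    by (intros; unfold mesh, Rdiv; ring).
  apply (dominated_convergence (fun p j => if (Z.abs j <=? Z.of_nat p)%Z then
      cos (PI * (IZR j + half e) / IZR (odd_nat p)) ^ (2 * steps s p) else 0)
    (theta_term false (half e) (PI ^ 2 * s)) _ M _ _ HM).
  - intros p j; unfold theta_term, ch; simpl andb; cbv iota; rewrite Rmult_1_l.
    destruct (Z.leb_spec (Z.abs j) (Z.of_nat p)) as [D|D].
    + rewrite Ec.
      destruct (cos_pow_le s p (PI * (IZR j + half e)) Hs) as [B U].
      (* The angle stays within PI / 2 since |j + half e| <= p + 1/2, which is half of
         [odd_nat p]. *)
      * rewrite <- Ec; unfold Rdiv; rewrite !Rabs_mult, Rabs_inv.
        pose proof (odd_nat_ge1 p) as Hl; rewrite (Rabs_pos_eq PI), (Rabs_pos_eq (IZR _)) by lra.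
        rewrite Rmult_assoc; apply Rmult_le_compat_l; [lra|].
        apply (Rmult_le_reg_r (IZR (odd_nat p))); [lra|].
        rewrite Rmult_assoc, Rinv_l, odd_nat_INR by lra.
        assert (Rabs (IZR j) <= INR p) by (rewrite <- abs_IZR, INR_IZR_INZ; now apply IZR_le).
        assert (Rabs (half e) <= 1 / 2)
          by (unfold half; destruct e; [rewrite Rabs_pos_eq|rewrite Rabs_R0]; lra).
        pose proof (Rabs_triang (IZR j) (half e)); lra.
      * rewrite Rabs_pos_eq by exact B; eapply Rle_trans; [exact U|right; f_equal; field].
    + rewrite Rabs_R0; left; apply exp_pos.
  - intros j; apply (is_lim_seq_ext_loc (fun p =>
      cos (PI * (IZR j + half e) * mesh p) ^ (2 * steps s p))).
    + exists (Z.abs_nat j); intros p Hp; rewrite Ec.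
      destruct (Z.leb_spec (Z.abs j) (Z.of_nat p)); [easy|lia].
    + unfold theta_term, ch; simpl andb; cbv iota; rewrite Rmult_1_l.
      replace (PI ^ 2 * s * (IZR j + half e) ^ 2) with (s * (PI * (IZR j + half e)) ^ 2) by ring.
      now apply cos_pow_lim.
  - intros p.
    rewrite (lsum_ext_in _ (fun j => if (Z.abs j <=? Z.of_nat p)%Z then
      cos (PI * (IZR j + half e) / IZR (odd_nat p)) ^ (2 * steps s p) else 0)).
    + apply has_sum_finite; [apply interval_NoDup|].
      intros j Hj; rewrite interval_spec in Hj.
      destruct (Z.leb_spec (Z.abs j) (Z.of_nat p)); [lia|easy].
    + intros j Hj; rewrite interval_spec in Hj.
      destruct (Z.leb_spec (Z.abs j) (Z.of_nat p)); [easy|lia].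
  - now apply Th_has_sum.
Qed.

(* The common factor of the two inversion formulas cancels in this ratio, so the
   asymptotics of the central binomial coefficient are not needed. *)
Lemma theta_inversion_ratio s : 0 < s ->
  Th true 0 (1 / s) * Th false 0 (PI ^ 2 * s) = Th false 0 (1 / s) * Th false (1 / 2) (PI ^ 2 * s).
Proof.
  intros Hs.
  set (R := fun e p => lsum (fun j =>
    cos (PI * (IZR j + half e) / IZR (odd_nat p)) ^ (2 * steps s p)) (interval p)).
  set (k := fun p => 2 ^ (2 * steps s p) / (IZR (odd_nat p) * bin (steps s p) 0)).
  assert (L : forall e, is_lim_seq (fun p => k p * R e p) (Th e 0 (1 / s))).
  { intros e; apply theta_binomial_limit; [exact Hs|].
    intros p; apply (bin_roots e p (steps s p)). }
  assert (L1 : is_lim_seq (fun p => k p * R true p * R false p)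
    (Th true 0 (1 / s) * Th false 0 (PI ^ 2 * s))).
  { apply is_lim_seq_mult'; [apply L|apply (theta_cosine_limit false s Hs)]. }
  assert (L2 : is_lim_seq (fun p => k p * R true p * R false p)
    (Th false 0 (1 / s) * Th false (1 / 2) (PI ^ 2 * s))).
  { apply (is_lim_seq_ext (fun p => k p * R false p * R true p)); [intros; ring|].
    apply is_lim_seq_mult'; [apply L|apply (theta_cosine_limit true s Hs)]. }
  apply is_lim_seq_unique in L1; apply is_lim_seq_unique in L2.
  rewrite L1 in L2; now injection L2.
Qed.

(** * The continued fraction as a theta quotient *)

(** The q-Pochhammer symbol (q; q)_n at q = exp(-t). *)
Fixpoint poch (t : R) (n : nat) : R :=
  match n with
  | O => 1
  | S m => poch t m * (1 - exp (- (t * INR (S m))))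
  end.

Lemma exp_neg_bounds y : 0 < y -> 0 < exp (- y) < 1.
Proof.
  intros Hy; split; [apply exp_pos|rewrite <- exp_0; apply exp_increasing; lra].
Qed.

Lemma poch_factor t m : 0 < t -> 0 < 1 - exp (- (t * INR (S m))) < 1.
Proof.
  intros Ht; assert (0 < t * INR (S m)) by (apply Rmult_lt_0_compat; [lra|apply lt_0_INR; lia]).
  pose proof (exp_neg_bounds _ H); lra.
Qed.

Lemma poch_pos t n : 0 < t -> 0 < poch t n.
Proof.
  intros Ht; induction n as [|n IH]; [simpl; lra|].
  change (poch t (S n)) with (poch t n * (1 - exp (- (t * INR (S n))))).
  apply Rmult_lt_0_compat; [exact IH|now apply poch_factor].
Qed.

Lemma poch_ratio_le t n k : 0 < t -> 0 < poch t (n + k) / poch t n <= 1.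
Proof.
  intros Ht; pose proof (poch_pos t n Ht) as Hn.
  split; [apply Rdiv_lt_0_compat; [now apply poch_pos|exact Hn]|].
  apply Rcomplements.Rle_div_l; [exact Hn|]; rewrite Rmult_1_l.
  induction k as [|k IH]; [rewrite Nat.add_0_r; lra|].
  rewrite Nat.add_succ_r.
  change (poch t (S (n + k))) with (poch t (n + k) * (1 - exp (- (t * INR (S (n + k)))))).
  pose proof (poch_factor t (n + k) Ht); pose proof (poch_pos t (n + k) Ht); nra.
Qed.

(** As x^n <= x, each factor 1 - x^n is at least exp(-x^n / (1 - x)), and these exponents form a
    geometric series with sum x / (1 - x)^2. *)
Lemma poch_lower t : 0 < t -> exists c, 0 < c /\ forall n, c <= poch t n.
Proof.
  intros Ht; pose proof (exp_neg_bounds t Ht) as Hx; set (x := exp (- t)) in *.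
  exists (exp (- (x / (1 - x) ^ 2))); split; [apply exp_pos|]; intros n.
  apply Rle_trans with (exp (- (x * (1 - x ^ n) / (1 - x) ^ 2))).
  - apply exp_le_compat, Ropp_le_contravar; unfold Rdiv.
    apply Rmult_le_compat_r; [left; apply Rinv_0_lt_compat, pow_lt; lra|].
    pose proof (pow_lt x n ltac:(lra)); nra.
  - induction n as [|n IH].
    + simpl; right; unfold Rdiv; rewrite Rminus_diag, Rmult_0_r, Rmult_0_l, Ropp_0; apply exp_0.
    + change (poch t (S n)) with (poch t n * (1 - exp (- (t * INR (S n))))).
      replace (exp (- (t * INR (S n)))) with (x ^ S n) by (unfold x; rewrite exp_pow; f_equal; ring).
      assert (Hxn : 0 < x ^ S n <= x).
      { split; [apply pow_lt; lra|].
        simpl; pose proof (pow_incr x 1 n ltac:(lra)); rewrite pow1 in *; nra. }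
      destruct (one_minus_exp (x ^ S n)) as [L _]; [lra|].
      replace (- (x * (1 - x ^ S n) / (1 - x) ^ 2)) with
        (- (x * (1 - x ^ n) / (1 - x) ^ 2) + - (x ^ S n / (1 - x))) by (simpl; field; lra).
      rewrite exp_plus; apply Rmult_le_compat; try (left; apply exp_pos); [exact IH|].
      eapply Rle_trans; [|exact L]; apply exp_le_compat, Ropp_le_contravar.
      apply Rmult_le_compat_l; [lra|apply Rinv_le_contravar; lra].
Qed.

(* The terms of the series H_m(a) in Hardy and Wright, section 19.14, at
   a = q^(k+1) with q = exp(-t), up to the constant factor (q; q)_infinity. *)
Definition hw_term (t m : R) (k r : nat) : R :=
  (-1) ^ r *
  exp (- (t * (2 * INR r * (INR k + 1) + INR r * (5 * INR r + 1) / 2 - m * INR r))) *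
  (1 - exp (- (t * (m * (INR k + 1) + 2 * m * INR r)))) * (poch t (r + k) / poch t r).

Definition hw (t m : R) (k : nat) : R := Sum (hw_term t m k).

Lemma pow_m1_abs r : Rabs ((-1) ^ r) = 1.
Proof. rewrite <- RPow_abs, Rabs_left by lra; replace (- (-1)) with 1 by ring; apply pow1. Qed.

Lemma exp_neg_le1 y : 0 <= y -> exp (- y) <= 1.
Proof. intros Hy; rewrite <- exp_0; apply exp_le_compat; lra. Qed.

Lemma mult_le_self w u v : 0 <= w -> 0 <= u <= 1 -> 0 <= v <= 1 -> w * u * v <= w.
Proof. intros Hw Hu Hv; assert (0 <= u * v <= 1) by nra; rewrite Rmult_assoc; nra. Qed.

Lemma signed_term_bound t y r u v : 0 < t -> INR r <= y -> 0 <= u <= 1 -> 0 <= v <= 1 ->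
  Rabs ((-1) ^ r * exp (- (t * y)) * u * v) <= exp (- t) ^ r.
Proof.
  intros Ht Hy Hu Hv.
  rewrite !Rabs_mult, pow_m1_abs, Rmult_1_l, (Rabs_pos_eq u), (Rabs_pos_eq v) by lra.
  rewrite (Rabs_pos_eq (exp _)) by (left; apply exp_pos).
  apply Rle_trans with (exp (- (t * y))).
  - apply mult_le_self; [left; apply exp_pos|exact Hu|exact Hv].
  - rewrite exp_pow; apply exp_le_compat; nra.
Qed.

Lemma INR_le_sqr r : INR r <= INR r ^ 2.
Proof.
  destruct r as [|r]; [simpl; lra|].
  assert (1 <= INR (S r)) by (rewrite S_INR; pose proof (pos_INR r); lra); nra.
Qed.

Lemma hw_term_bound t m k r : 0 < t -> 0 <= m <= 2 -> Rabs (hw_term t m k r) <= exp (- t) ^ r.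
Proof.
  intros Ht Hm; pose proof (pos_INR r) as Hr; pose proof (pos_INR k) as Hk.
  pose proof (INR_le_sqr r) as Hr2.
  unfold hw_term; apply signed_term_bound; [exact Ht| | |].
  - assert (0 <= INR r * INR k) by now apply Rmult_le_pos.
    assert (m * INR r <= 2 * INR r) by (apply Rmult_le_compat_r; lra); lra.
  - assert (0 <= t * (m * (INR k + 1) + 2 * m * INR r)).
    { apply Rmult_le_pos; [lra|apply Rplus_le_le_0_compat; repeat apply Rmult_le_pos; lra]. }
    pose proof (exp_neg_le1 _ H); pose proof (exp_pos (- (t * (m * (INR k + 1) + 2 * m * INR r)))); lra.
  - pose proof (poch_ratio_le t r k Ht); lra.
Qed.

Lemma abs_bounded_nat_geom (f : nat -> R) t : 0 < t ->
  (forall r, Rabs (f r) <= exp (- t) ^ r) -> exists M, abs_bounded f M.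
Proof.
  intros Ht Hf.
  pose proof (abs_bounded_geom (fun n => f (Z.abs_nat n)) 1 (exp (- t)) (exp_neg_bounds t Ht)
    ltac:(lra)) as H.
  eexists; eapply abs_bounded_le;
    [|apply (abs_bounded_comp (fun n => f (Z.abs_nat n)) Z.of_nat _ Nat2Z.inj), H].
  - intros r; cbv beta; replace (Z.abs_nat (Z.of_nat r)) with r by lia; lra.
  - intros n; rewrite Rmult_1_l; apply Hf.
Qed.

Lemma hw_has_sum t m k : 0 < t -> 0 <= m <= 2 -> has_sum (hw_term t m k) (hw t m k).
Proof.
  intros Ht Hm.
  destruct (abs_bounded_nat_geom (hw_term t m k) t Ht) as [M HM].
  { intros r; now apply hw_term_bound. }
  destruct (has_sum_exists _ _ HM) as [s Hs].
  unfold hw; rewrite (Sum_unique _ s); assumption.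
Qed.

Lemma has_sum_nat_succ (f : nat -> R) s : has_sum (fun r => f (S r)) s -> has_sum f (f 0%nat + s).
Proof.
  intros H.
  assert (H0 : has_sum (fun r => match r with O => f O | S _ => 0 end) (f 0%nat)).
  { pose proof (has_sum_finite (fun r => match r with O => f O | S _ => 0 end) [0%nat]) as Q.
    unfold lsum in Q; simpl in Q; rewrite Rplus_0_r in Q.
    apply Q; [repeat constructor; easy|].
    intros [|r] Hr; [exfalso; apply Hr; now left|easy]. }
  assert (H1 : has_sum (fun r => match r with O => 0 | S _ => f r end) s).
  { apply (has_sum_inj _ S); [congruence| |exact H].
    intros [|r] Hr; [easy|now exists r]. }
  eapply has_sum_ext; [|exact (has_sum_plus _ _ _ _ H0 H1)].
  intros [|r]; ring.
Qed.

(** With a = q^(k+1), this is H_m(a) - H_(m-1)(a) = a^(m-1) H_(3-m)(aq). Termwise the left side is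
    [v r + z r] and the right side [v r + z (S r)]; since [z 0 = 0], moving [z] by one index does
    not change the sum. *)
Lemma hw_rec t m k : 0 < t -> 1 <= m <= 2 ->
  hw t m k - hw t (m - 1) k = exp (- (t * ((INR k + 1) * (m - 1)))) * hw t (3 - m) (S k).
Proof.
  intros Ht Hm.
  set (v := fun r => (-1) ^ r *
    exp (- (t * ((2 * INR r + m - 1) * (INR k + 1) + INR r * (5 * INR r + 1) / 2 + INR r * (m - 1)))) *
    1 * (poch t (r + S k) / poch t r)).
  set (z := fun r => (-1) ^ r *
    exp (- (t * (2 * INR r * (INR k + 1) + INR r * (5 * INR r + 1) / 2 - m * INR r))) *
    (1 - exp (- (t * INR r))) * (poch t (r + k) / poch t r)).
  assert (Hz0 : z 0%nat = 0).
  { unfold z; simpl INR; rewrite (Rmult_0_r t), Ropp_0, exp_0; ring. }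
  assert (Hv : exists s, has_sum v s).
  { destruct (abs_bounded_nat_geom v t Ht) as [M HM]; [|now apply (has_sum_exists _ M)].
    intros r; pose proof (pos_INR r) as Hr; pose proof (pos_INR k) as Hk.
    pose proof (INR_le_sqr r) as Hr2.
    unfold v; apply signed_term_bound; [exact Ht| |lra|].
    - assert (0 <= INR r * INR k) by now apply Rmult_le_pos.
      assert (0 <= (m - 1) * (INR k + 1)) by (apply Rmult_le_pos; lra).
      assert (0 <= INR r * (m - 1)) by (apply Rmult_le_pos; lra); lra.
    - pose proof (poch_ratio_le t r (S k) Ht); lra. }
  destruct Hv as [sv Hv].
  assert (E1 : forall r, hw_term t m k r - hw_term t (m - 1) k r = v r + z r).
  { intros r; unfold hw_term, v, z.
    rewrite Nat.add_succ_r.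
    change (poch t (S (r + k))) with (poch t (r + k) * (1 - exp (- (t * INR (S (r + k)))))).
    rewrite S_INR, plus_INR; pose proof (poch_pos t r Ht).
    set (P := poch t (r + k)).
    transitivity ((-1) ^ r * P / poch t r *
      (exp (- (t * (2 * INR r * (INR k + 1) + INR r * (5 * INR r + 1) / 2 - m * INR r))) -
       exp (- (t * (2 * INR r * (INR k + 1) + INR r * (5 * INR r + 1) / 2 - m * INR r)) +
            - (t * (m * (INR k + 1) + 2 * m * INR r))) -
       exp (- (t * (2 * INR r * (INR k + 1) + INR r * (5 * INR r + 1) / 2 - (m - 1) * INR r))) +
       exp (- (t * (2 * INR r * (INR k + 1) + INR r * (5 * INR r + 1) / 2 - (m - 1) * INR r)) +
            - (t * ((m - 1) * (INR k + 1) + 2 * (m - 1) * INR r))))).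
    - rewrite !exp_plus; field; lra.
    - transitivity ((-1) ^ r * P / poch t r *
       (exp (- (t * ((2 * INR r + m - 1) * (INR k + 1) + INR r * (5 * INR r + 1) / 2 + INR r * (m - 1)))) -
        exp (- (t * ((2 * INR r + m - 1) * (INR k + 1) + INR r * (5 * INR r + 1) / 2 + INR r * (m - 1))) +
             - (t * (INR r + INR k + 1))) +
        exp (- (t * (2 * INR r * (INR k + 1) + INR r * (5 * INR r + 1) / 2 - m * INR r))) -
        exp (- (t * (2 * INR r * (INR k + 1) + INR r * (5 * INR r + 1) / 2 - m * INR r)) +
             - (t * INR r)))).
      + f_equal.
        match goal with |- ?a - exp ?b - exp ?c + exp ?d = exp ?e - exp ?f + ?a - exp ?g =>
          replace f with b by field; replace g with c by field; replace e with d by field end.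
        ring.
      + rewrite !exp_plus; field; lra. }
  assert (E2 : forall r, v r + z (S r) =
    exp (- (t * ((INR k + 1) * (m - 1)))) * hw_term t (3 - m) (S k) r).
  { intros r; unfold hw_term, v, z.
    replace (S r + k)%nat with (S (r + k)) by lia; rewrite Nat.add_succ_r.
    change (poch t (S r)) with (poch t r * (1 - exp (- (t * INR (S r))))).
    pose proof (poch_pos t r Ht); pose proof (poch_factor t r Ht) as Hf.
    set (P := poch t (S (r + k))).
    set (w := 1 - exp (- (t * INR (S r)))) in *.
    rewrite !S_INR; simpl pow.
    transitivity ((-1) ^ r * P / poch t r *
      (exp (- (t * ((2 * INR r + m - 1) * (INR k + 1) + INR r * (5 * INR r + 1) / 2 + INR r * (m - 1)))) -
       exp (- (t * (2 * (INR r + 1) * (INR k + 1) + (INR r + 1) * (5 * (INR r + 1) + 1) / 2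
         - m * (INR r + 1)))))).
    - field; lra.
    - transitivity ((-1) ^ r * P / poch t r *
       (exp (- (t * ((INR k + 1) * (m - 1))) +
          - (t * (2 * INR r * (INR k + 1 + 1) + INR r * (5 * INR r + 1) / 2 - (3 - m) * INR r))) -
        exp (- (t * ((INR k + 1) * (m - 1))) +
          - (t * (2 * INR r * (INR k + 1 + 1) + INR r * (5 * INR r + 1) / 2 - (3 - m) * INR r)) +
          - (t * ((3 - m) * (INR k + 1 + 1) + 2 * (3 - m) * INR r))))).
      + f_equal; f_equal; f_equal; field.
      + rewrite !exp_plus; field; lra. }
  pose proof (has_sum_minus _ _ _ _ (hw_has_sum t m k Ht ltac:(lra))
    (hw_has_sum t (m - 1) k Ht ltac:(lra))) as H1.
  pose proof (has_sum_scal (exp (- (t * ((INR k + 1) * (m - 1))))) _ _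
    (hw_has_sum t (3 - m) (S k) Ht ltac:(lra))) as H2.
  pose proof (has_sum_minus _ _ _ _ H2 Hv) as H3.
  apply (has_sum_ext _ (fun r => z (S r))) in H3; [|intros r; rewrite <- E2; ring].
  apply has_sum_nat_succ in H3; rewrite Hz0, Rplus_0_l in H3.
  pose proof (has_sum_plus _ _ _ _ Hv H3) as H4.
  apply (has_sum_unique _ _ _ H1).
  eapply has_sum_ext; [intros r; symmetry; apply E1|].
  match goal with |- has_sum _ ?s => replace s with (sv + (s - sv)) by ring end; exact H4.
Qed.

Lemma hw_0 t k : 0 < t -> hw t 0 k = 0.
Proof.
  intros Ht; apply (has_sum_unique (hw_term t 0 k)); [apply hw_has_sum; lra|].
  pose proof (has_sum_finite (hw_term t 0 k) []) as Q; apply Q; [constructor|].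
  intros r _; unfold hw_term.
  replace (t * (0 * (INR k + 1) + 2 * 0 * INR r)) with 0 by ring.
  rewrite Ropp_0, exp_0; ring.
Qed.

Lemma hw_1 t k : 0 < t -> hw t 1 k = hw t 2 (S k).
Proof.
  intros Ht; pose proof (hw_rec t 1 k Ht ltac:(lra)) as H.
  replace (1 - 1) with 0 in H by ring; replace (3 - 1) with 2 in H by ring.
  rewrite hw_0, !Rmult_0_r, Ropp_0, exp_0 in H by exact Ht; lra.
Qed.

(** Divided by [hw t 2 (S k)], this is the recursion satisfied by the tails of the continued
    fraction. *)
Lemma hw_2 t k : 0 < t -> hw t 2 k = hw t 2 (S k) + exp (- t) ^ S k * hw t 2 (S (S k)).
Proof.
  intros Ht; pose proof (hw_rec t 2 k Ht ltac:(lra)) as H.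
  replace (2 - 1) with 1 in H by ring; replace (3 - 2) with 1 in H by ring.
  rewrite !hw_1, Rmult_1_r in H by exact Ht.
  rewrite exp_pow, S_INR; replace ((INR k + 1) * - t) with (- (t * (INR k + 1))) by ring; lra.
Qed.

(** The terms with r >= 1 tend to 0 in k under a geometric majorant, while the term r = 0 stays
    above (1 - q) c, with c from [poch_lower]. *)
Lemma hw_2_eventually_pos t : 0 < t -> exists N, forall k, (N <= k)%nat -> 0 < hw t 2 k.
Proof.
  intros Ht; pose proof (exp_neg_bounds t Ht) as Hx.
  set (s := fun k => hw t 2 k - hw_term t 2 k 0).
  destruct (abs_bounded_nat_geom (fun r => exp (- t) ^ r) t Ht) as [M HM].
  { intros r; rewrite Rabs_pos_eq; [lra|apply pow_le; lra]. }
  pose proof (abs_bounded_comp _ S _ ltac:(congruence) HM) as HM'.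
  assert (Hb : forall k r, Rabs (hw_term t 2 k (S r)) <= exp (- t) ^ S r).
  { intros k r; apply hw_term_bound; lra. }
  assert (Hs : forall k, has_sum (fun r => hw_term t 2 k (S r)) (s k)).
  { intros k; destruct (has_sum_exists (fun r => hw_term t 2 k (S r)) M) as [s' Hs'].
    - eapply abs_bounded_le; [|exact HM'].
      intros r; cbv beta; rewrite (Rabs_pos_eq (exp (- t) ^ S r)); [apply Hb|apply pow_le; lra].
    - replace (s k) with s'; [exact Hs'|].
      pose proof (has_sum_unique _ _ _ (has_sum_nat_succ _ _ Hs') (hw_has_sum t 2 k Ht ltac:(lra))).
      unfold s; lra. }
  assert (L : is_lim_seq s 0).
  { apply (dominated_convergence (fun k r => hw_term t 2 k (S r)) (fun _ => 0) _ _ s 0 HM' Hb).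
    - intros r; apply is_lim_seq_abs_0.
      apply (is_lim_seq_le_le (fun _ => 0) _ (fun k => exp (- t) ^ k)).
      + intros k; split; [apply Rabs_pos|].
        unfold hw_term; rewrite !Rabs_mult, pow_m1_abs, Rmult_1_l.
        pose proof (poch_ratio_le t (S r) k Ht) as Hp.
        rewrite (Rabs_pos_eq (_ / _)) by lra.
        assert (He : 0 <= 1 - exp (- (t * (2 * (INR k + 1) + 2 * 2 * INR (S r)))) <= 1).
        { pose proof (pos_INR k); pose proof (pos_INR (S r)).
          pose proof (exp_neg_bounds (t * (2 * (INR k + 1) + 2 * 2 * INR (S r)))) as Q.
          assert (0 < t * (2 * (INR k + 1) + 2 * 2 * INR (S r))) by (apply Rmult_lt_0_compat; lra).
          specialize (Q H1); lra. }
        rewrite (Rabs_pos_eq (1 - _)) by lra.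
        rewrite (Rabs_pos_eq (exp _)) by (left; apply exp_pos).
        assert (Hy : exp (- (t * (2 * INR (S r) * (INR k + 1) + INR (S r) * (5 * INR (S r) + 1) / 2 -
          2 * INR (S r)))) <= exp (- t) ^ k).
        { rewrite exp_pow; apply exp_le_compat; rewrite S_INR.
          pose proof (pos_INR k); pose proof (pos_INR r).
          assert (0 <= INR r * INR k) by now apply Rmult_le_pos.
          assert (0 <= INR r * INR r) by now apply Rmult_le_pos.
          enough (Q : INR k <= 2 * (INR r + 1) * (INR k + 1) +
            (INR r + 1) * (5 * (INR r + 1) + 1) / 2 - 2 * (INR r + 1))
            by (apply (Rmult_le_compat_l t) in Q; lra).
          lra. }
        eapply Rle_trans; [|exact Hy].
        apply mult_le_self; [left; apply exp_pos|exact He|lra].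
      + apply is_lim_seq_const.
      + apply is_lim_seq_geom; rewrite Rabs_pos_eq; lra.
    - exact Hs.
    - pose proof (has_sum_finite (fun _ : nat => 0) []) as Q; apply Q; [constructor|easy]. }
  destruct (poch_lower t Ht) as [c [Hc HcP]].
  assert (Hc' : 0 < (1 - exp (- t)) * c) by (apply Rmult_lt_0_compat; lra).
  apply is_lim_seq_spec in L; destruct (L (mkposreal _ Hc')) as [N HN].
  exists N; intros k Hk; specialize (HN k Hk); cbn [pos] in HN; apply Rabs_def2 in HN.
  assert (H0 : (1 - exp (- t)) * c <= hw_term t 2 k 0); [|unfold s in HN; lra].
  unfold hw_term; simpl INR; simpl pow; rewrite Nat.add_0_l; change (poch t 0) with 1.
  replace (t * (2 * 0 * (INR k + 1) + 0 * (5 * 0 + 1) / 2 - 2 * 0)) with 0 by field.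
  rewrite Ropp_0, exp_0, !Rmult_1_l; unfold Rdiv; rewrite Rinv_1, Rmult_1_r.
  apply Rmult_le_compat; try lra; [|apply HcP].
  apply Rplus_le_compat_l, Ropp_le_contravar, exp_le_compat, Ropp_le_contravar.
  pose proof (pos_INR k); nra.
Qed.

(** The recurrence [hw_2] has positive coefficients and so carries positivity down to all smaller
    k. *)
Lemma hw_2_pos t k : 0 < t -> 0 < hw t 2 k.
Proof.
  intros Ht; destruct (hw_2_eventually_pos t Ht) as [N HN].
  assert (D : forall n k, (N <= k + n)%nat -> 0 < hw t 2 k).
  { induction n as [|n IH]; intros j Hj; [apply HN; lia|].
    rewrite hw_2 by exact Ht.
    pose proof (IH (S j) ltac:(lia)); pose proof (IH (S (S j)) ltac:(lia)).
    assert (0 < exp (- t) ^ S j) by apply pow_lt, exp_pos; nra. }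
  apply (D N); lia.
Qed.

(** Truncation and exact tail obey the same recursion, and both are at least 1, so each level
    multiplies the error by at most q. *)
Lemma RR_denom_hw t n k : 0 < t ->
  Rabs (RR_denom (exp (- t)) (S k) n - hw t 2 k / hw t 2 (S k)) <= exp (- t) ^ n.
Proof.
  intros Ht; pose proof (exp_neg_bounds t Ht) as Hq; set (q := exp (- t)) in *.
  assert (HT : forall j, hw t 2 j / hw t 2 (S j) = 1 + q ^ S j / (hw t 2 (S j) / hw t 2 (S (S j)))).
  { intros j; pose proof (hw_2_pos t (S j) Ht); pose proof (hw_2_pos t (S (S j)) Ht).
    rewrite (hw_2 t j Ht); fold q; field; lra. }
  assert (Hp : forall j, 0 < q ^ S j <= q).
  { intros j; split; [apply pow_lt; lra|].
    simpl; pose proof (pow_incr q 1 j ltac:(lra)); rewrite pow1 in *; nra. }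
  assert (HT1 : forall j, 1 <= hw t 2 j / hw t 2 (S j)).
  { intros j; rewrite HT; specialize (Hp j).
    assert (0 < q ^ S j / (hw t 2 (S j) / hw t 2 (S (S j)))); [|lra].
    repeat apply Rdiv_lt_0_compat; try apply hw_2_pos; lra. }
  revert k; induction n as [|n IH]; intros k.
  - simpl RR_denom; rewrite HT; specialize (Hp k); specialize (HT1 (S k)).
    set (T := hw t 2 (S k) / hw t 2 (S (S k))) in *.
    replace (1 - (1 + q ^ S k / T)) with (- (q ^ S k / T)) by ring.
    rewrite Rabs_Ropp, Rabs_pos_eq by (apply Rcomplements.Rdiv_le_0_compat; lra).
    apply Rcomplements.Rle_div_l; rewrite ?pow_O; lra.
  - change (RR_denom q (S k) (S n)) with (1 + q ^ S k / RR_denom q (S (S k)) n).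
    rewrite HT; specialize (Hp k); specialize (HT1 (S k)); specialize (IH (S k)).
    pose proof (RR_denom_ge1 q n (proj1 Hq) (S (S k))) as HD.
    set (T := hw t 2 (S k) / hw t 2 (S (S k))) in *; set (D := RR_denom q (S (S k)) n) in *.
    replace (1 + q ^ S k / D - (1 + q ^ S k / T)) with (q ^ S k * / (D * T) * (- (D - T)))
      by (field; lra).
    rewrite !Rabs_mult, Rabs_Ropp, (Rabs_pos_eq (q ^ S k)) by lra.
    assert (HDT : 0 <= / (D * T) <= 1).
    { split; [left; apply Rinv_0_lt_compat; nra|].
      rewrite <- Rinv_1; apply Rinv_le_contravar; nra. }
    rewrite (Rabs_pos_eq (/ (D * T))) by lra.
    rewrite <- (tech_pow_Rmult q n).
    apply Rmult_le_compat; try apply Rabs_pos; [nra|nra|exact IH].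
Qed.

(** At k = 0 the Pochhammer quotient is 1, and the two parts of the factor 1 - exp(...) are the
    theta terms n = r and n = -1 - r after completing the square. *)
Lemma hw_theta t m : 0 < t -> 0 <= m <= 2 ->
  let a := (5 - 2 * m) / 10 in
  exp (- (5 / 2 * t * a ^ 2)) * hw t m 0 = Th true a (5 / 2 * t).
Proof.
  intros Ht Hm a.
  set (f := theta_term true a (5 / 2 * t)).
  assert (Hs : 0 < 5 / 2 * t) by lra.
  destruct (theta_term_bounded true a _ Hs) as [M HM]; fold f in HM.
  set (g := fun r : nat => (-1 - Z.of_nat r)%Z).
  assert (Hg : forall u v, g u = g v -> u = v) by (unfold g; intros; lia).
  destruct (has_sum_exists _ _ (abs_bounded_comp f Z.of_nat M Nat2Z.inj HM)) as [s1 H1].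
  destruct (has_sum_exists _ _ (abs_bounded_comp f g M Hg HM)) as [s2 H2].
  assert (P1 : has_sum (fun n => if (0 <=? n)%Z then f n else 0) s1).
  { apply (has_sum_inj _ Z.of_nat); [exact Nat2Z.inj| |].
    - intros n Hn; destruct (Z.leb_spec 0 n); [|easy].
      exists (Z.to_nat n); lia.
    - eapply has_sum_ext; [|exact H1]; intros r.
      destruct (Z.leb_spec 0 (Z.of_nat r)); [easy|lia]. }
  assert (P2 : has_sum (fun n => if (0 <=? n)%Z then 0 else f n) s2).
  { apply (has_sum_inj _ g); [exact Hg| |].
    - intros n Hn; destruct (Z.leb_spec 0 n); [easy|].
      exists (Z.to_nat (-1 - n)); unfold g; lia.
    - eapply has_sum_ext; [|exact H2]; intros r; unfold g.
      destruct (Z.leb_spec 0 (-1 - Z.of_nat r)); [lia|easy]. }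
  transitivity (s1 + s2).
  - apply (has_sum_unique (fun r => f (Z.of_nat r) + f (g r))); [|now apply has_sum_plus].
    eapply has_sum_ext; [|apply has_sum_scal, hw_has_sum; eassumption].
    intros r; unfold f, g, theta_term, hw_term.
    rewrite Nat.add_0_r; pose proof (poch_pos t r Ht).
    assert (C1 : ch true (Z.of_nat r) = (-1) ^ r /\ ch true (-1 - Z.of_nat r) = - (-1) ^ r).
    { unfold ch; clear; rewrite Z.odd_sub; induction r as [|r [I1 I2]]; [simpl; split; ring|].
      rewrite Nat2Z.inj_succ, Z.odd_succ, <- Z.negb_odd in *.
      simpl pow; destruct (Z.odd (Z.of_nat r)); simpl in *; split; lra. }
    destruct C1 as [-> ->]; rewrite minus_IZR, <- INR_IZR_INZ; simpl INR.
    transitivity ((-1) ^ r *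
      (exp (- (5 / 2 * t * a ^ 2) +
        - (t * (2 * INR r * (0 + 1) + INR r * (5 * INR r + 1) / 2 - m * INR r))) -
       exp (- (5 / 2 * t * a ^ 2) +
        - (t * (2 * INR r * (0 + 1) + INR r * (5 * INR r + 1) / 2 - m * INR r)) +
        - (t * (m * (0 + 1) + 2 * m * INR r))))).
    + rewrite !exp_plus; field; lra.
    + replace (- (5 / 2 * t * a ^ 2) +
        - (t * (2 * INR r * (0 + 1) + INR r * (5 * INR r + 1) / 2 - m * INR r)))
        with (- (5 / 2 * t * (INR r + a) ^ 2)) by (unfold a; field).
      replace (- (5 / 2 * t * (INR r + a) ^ 2) + - (t * (m * (0 + 1) + 2 * m * INR r)))
        with (- (5 / 2 * t * (-1 - INR r + a) ^ 2)) by (unfold a; field); ring.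
  - apply (has_sum_unique f); [|now apply Th_has_sum].
    eapply has_sum_ext; [|exact (has_sum_plus _ _ _ _ P1 P2)].
    intros n; cbv beta; destruct (0 <=? n)%Z; ring.
Qed.

Lemma RogersRamanujan_theta t : 0 < t ->
  RogersRamanujan (exp (- t)) = Th true (3 / 10) (5 / 2 * t) / Th true (1 / 10) (5 / 2 * t).
Proof.
  intros Ht; pose proof (exp_neg_bounds t Ht) as Hq.
  pose proof (hw_2_pos t 0 Ht) as H0; pose proof (hw_2_pos t 1 Ht) as H1.
  assert (L : is_lim_seq (RR_denom (exp (- t)) 1) (hw t 2 0 / hw t 2 1)).
  { apply (is_lim_seq_ext (fun n => (RR_denom (exp (- t)) 1 n - hw t 2 0 / hw t 2 1)
      + hw t 2 0 / hw t 2 1)); [intros; ring|].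
    rewrite <- (Rplus_0_l (hw t 2 0 / hw t 2 1)) at 1.
    apply is_lim_seq_plus'; [|apply is_lim_seq_const].
    apply is_lim_seq_abs_0, (is_lim_seq_le_le (fun _ => 0) _ (fun n => exp (- t) ^ n)).
    - intros n; split; [apply Rabs_pos|now apply RR_denom_hw].
    - apply is_lim_seq_const.
    - apply is_lim_seq_geom; rewrite Rabs_pos_eq; lra. }
  assert (L' : is_lim_seq (RR_convergent (exp (- t)))
    (Rpower (exp (- t)) (1 / 5) / (hw t 2 0 / hw t 2 1))).
  { apply is_lim_seq_div'; [apply is_lim_seq_const|exact L|].
    apply Rgt_not_eq, Rdiv_lt_0_compat; lra. }
  unfold RogersRamanujan; rewrite (is_lim_seq_unique _ _ L'); cbn [real].
  pose proof (hw_theta t 2 Ht ltac:(lra)) as E2; pose proof (hw_theta t 1 Ht ltac:(lra)) as E1.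
  cbv zeta in E1, E2; rewrite hw_1 in E1 by exact Ht.
  replace ((5 - 2 * 2) / 10) with (1 / 10) in E2 by field.
  replace ((5 - 2 * 1) / 10) with (3 / 10) in E1 by field.
  rewrite <- E1, <- E2; unfold Rpower; rewrite ln_exp.
  (* The prefactor q^(1/5) is the gap between the two completed squares: 5/2 (9/100 - 1/100) =
     1/5. *)
  replace (- (5 / 2 * t * (3 / 10) ^ 2)) with (1 / 5 * - t + - (5 / 2 * t * (1 / 10) ^ 2)) by field.
  rewrite exp_plus; pose proof (exp_pos (- (5 / 2 * t * (1 / 10) ^ 2))); field; lra.
Qed.

(** * The evaluation *)

(** The duplication formulas at 1/10 and 3/10 share alternating factors, which are positive and
    cancel. *)
Lemma theta_products s : 0 < s ->
  4 * (Th false (1 / 10) s * Th false (3 / 10) s) *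
    (Th true (1 / 5) (2 * s) * Th true (2 / 5) (2 * s)) =
  Th true 0 (2 * s) ^ 2 * Th false (1 / 2) s ^ 2.
Proof.
  intros Hs.
  pose proof (Th_true_pos (1 / 10) s Hs ltac:(lra)) as N1.
  pose proof (Th_true_pos (3 / 10) s Hs ltac:(lra)) as N3.
  pose proof (Th_true_pos (1 / 10) (2 * s) ltac:(lra) ltac:(lra)) as A1.
  pose proof (Th_true_pos (3 / 10) (2 * s) ltac:(lra) ltac:(lra)) as A3.
  pose proof (Th_false_true (1 / 10) s Hs) as E1.
  pose proof (Th_false_true (3 / 10) s Hs) as E3.
  pose proof (Th_half_mul (1 / 10) s Hs) as F1.
  pose proof (Th_half_mul (3 / 10) s Hs) as F3.
  replace ((1 / 2 + 1 / 10) / 2) with (3 / 10) in F1 by field.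
  replace ((1 / 2 - 1 / 10) / 2) with (1 / 5) in F1 by field.
  replace ((1 / 2 + 3 / 10) / 2) with (2 / 5) in F3 by field.
  replace ((1 / 2 - 3 / 10) / 2) with (1 / 10) in F3 by field.
  set (n1 := Th true (1 / 10) s) in *; set (n3 := Th true (3 / 10) s) in *.
  set (a1 := Th true (1 / 10) (2 * s)) in *; set (a3 := Th true (3 / 10) (2 * s)) in *.
  apply (Rmult_eq_reg_r (n1 * n3 * (a1 * a3))).
  2:{ apply Rgt_not_eq; repeat apply Rmult_lt_0_compat; assumption. }
  transitivity ((Th false (1 / 10) s * n1) * (Th false (3 / 10) s * n3) *
    ((2 * (a3 * Th true (1 / 5) (2 * s))) * (2 * (Th true (2 / 5) (2 * s) * a1)))); [ring|].
  rewrite E1, E3, <- F1, <- F3; ring.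
Qed.

Lemma Rdiv_pow_2 x y : y <> 0 -> (x / y) ^ 2 = x ^ 2 / y ^ 2.
Proof. intros Hy; field; exact Hy. Qed.

Lemma quintic_parameters t : 0 < t ->
  let y2 := Th false (1 / 2) (5 * t) in let y3 := Th false 0 (5 * t) in
  let y4 := Th true 0 (5 * t) in
  let m2 := Th false (1 / 2) t / y2 in let m3 := Th false 0 t / y3 in let m4 := Th true 0 t / y4 in
  exists a b c, 0 < a /\ 0 < b /\ 0 < c /\
    m3 ^ 2 = 1 + 4 * a /\ m4 ^ 2 = 1 - 4 * b /\ m2 ^ 2 = 1 + 4 * c /\
    4 * a * b * c = 1 /\ b * (m2 * m3 - 1) = 1 /\ c * (1 - m3 * m4) = 1.
Proof.
  intros Ht y2 y3 y4 m2 m3 m4.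
  set (A := Th false (1 / 5) (5 * t) * Th false (2 / 5) (5 * t)).
  set (B := Th true (1 / 5) (5 * t) * Th true (2 / 5) (5 * t)).
  set (C := Th false (1 / 10) (5 * t) * Th false (3 / 10) (5 * t)).
  assert (HA : 0 < A) by (apply Rmult_lt_0_compat; apply Th_false_pos; lra).
  assert (HB : 0 < B) by (apply Rmult_lt_0_compat; apply Th_true_pos; lra).
  assert (HC : 0 < C) by (apply Rmult_lt_0_compat; apply Th_false_pos; lra).
  assert (H2 : 0 < y2) by (apply Th_false_pos; lra).
  assert (H3 : 0 < y3) by (apply Th_false_pos; lra).
  assert (H4 : 0 < y4) by (apply Th_true_pos; lra).
  pose proof (theta_sqr_5 false t Ht) as E3; pose proof (theta_sqr_5 true t Ht) as E4.
  pose proof (theta2_sqr_5 t Ht) as E2; fold A in E3; fold B in E4; fold C in E2.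
  fold y2 in E2; fold y3 in E3; fold y4 in E4.
  unfold ch in E3, E4; simpl andb in E3, E4; cbv iota in E3, E4.
  (* [B2] is [B] at twice the argument and [C0] is [C] at half of it. The degree 5 relations at 2t
     and t/2 express m3 m4 and m2 m3 through them. *)
  set (B2 := Th true (1 / 5) (10 * t) * Th true (2 / 5) (10 * t)).
  set (C0 := Th false (1 / 10) (5 * (t / 2)) * Th false (3 / 10) (5 * (t / 2))).
  assert (EAB : A * B = B2 * (y3 * y4)).
  { transitivity ((Th false (1 / 5) (5 * t) * Th true (1 / 5) (5 * t)) *
      (Th false (2 / 5) (5 * t) * Th true (2 / 5) (5 * t))); [unfold A, B; ring|].
    unfold y3, y4; rewrite !Th_false_true by lra.
    replace (2 * (5 * t)) with (10 * t) by ring; unfold B2; ring. }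
  assert (ECB2 : 4 * C * B2 = y3 * y4 * y2 ^ 2).
  { pose proof (theta_products (5 * t) ltac:(lra)) as Q.
    replace (2 * (5 * t)) with (10 * t) in Q by ring; fold C y2 B2 in Q; rewrite Q.
    unfold y3, y4; rewrite Th_false_true by lra; replace (2 * (5 * t)) with (10 * t) by ring; ring. }
  assert (E34 : Th false 0 t * Th true 0 t = y3 * y4 - 4 * B2).
  { unfold y3, y4; rewrite !Th_false_true by lra.
    pose proof (theta_sqr_5 true (2 * t) ltac:(lra)) as Q; unfold ch in Q; simpl in Q.
    replace (5 * (2 * t)) with (10 * t) in Q by ring; replace (2 * (5 * t)) with (10 * t) by ring.
    fold B2 in Q; lra. }
  assert (EC0 : 2 * C0 * B = y4 ^ 2 * (y2 * y3)).
  { pose proof (theta_products (5 * (t / 2)) ltac:(lra)) as Q.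
    rewrite (theta2_sqr (5 * (t / 2))) in Q by lra.
    replace (2 * (5 * (t / 2))) with (5 * t) in Q by field; fold C0 B y2 y3 y4 in Q; lra. }
  assert (E23 : Th false (1 / 2) t * Th false 0 t = y2 * y3 + 2 * C0).
  { pose proof (theta2_sqr_5 (t / 2) ltac:(lra)) as Q; fold C0 in Q.
    rewrite (theta2_sqr (t / 2)), (theta2_sqr (5 * (t / 2))) in Q by lra.
    replace (2 * (5 * (t / 2))) with (5 * t) in Q by field.
    replace (2 * (t / 2)) with t in Q by field; fold y2 y3 in Q; lra. }
  exists (A / y3 ^ 2), (B / y4 ^ 2), (C / y2 ^ 2).
  assert (P : forall y, 0 < y -> 0 < y ^ 2) by (intros; now apply pow_lt).
  repeat split.
  - apply Rdiv_lt_0_compat; auto.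
  - apply Rdiv_lt_0_compat; auto.
  - apply Rdiv_lt_0_compat; auto.
  - unfold m3; rewrite Rdiv_pow_2, E3 by lra; field; lra.
  - unfold m4; rewrite Rdiv_pow_2, E4 by lra; field; lra.
  - unfold m2; rewrite Rdiv_pow_2, E2 by lra; field; lra.
  - transitivity ((A * B) * (4 * C) / (y2 ^ 2 * y3 ^ 2 * y4 ^ 2)); [field; lra|].
    rewrite EAB; transitivity ((4 * C * B2) * (y3 * y4) / (y2 ^ 2 * y3 ^ 2 * y4 ^ 2)); [field; lra|].
    rewrite ECB2; field; lra.
  - unfold m2, m3.
    transitivity (B * (Th false (1 / 2) t * Th false 0 t - y2 * y3) / (y4 ^ 2 * (y2 * y3)));
      [field; lra|].
    rewrite E23; transitivity ((2 * C0 * B) / (y4 ^ 2 * (y2 * y3))); [field; lra|].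
    rewrite EC0; field; lra.
  - unfold m3, m4.
    transitivity (C * (y3 * y4 - Th false 0 t * Th true 0 t) / (y2 ^ 2 * (y3 * y4)));
      [field; lra|].
    rewrite E34; transitivity ((4 * C * B2) / (y3 * y4 * y2 ^ 2)); [field; lra|].
    rewrite ECB2; field; lra.
Qed.

(* [X] and [W] are the fourth powers of theta_2 / theta_3 and theta_4 / theta_3 at 5t,
   and [d] is the product of these two quotients. *)
Lemma quintic_parameter_eq a b c m2 m3 m4 X W d :
  0 < a -> 0 < b -> 0 < c -> 0 < m2 -> 0 < m3 -> 0 < m4 ->
  m3 ^ 2 = 1 + 4 * a -> m4 ^ 2 = 1 - 4 * b -> m2 ^ 2 = 1 + 4 * c ->
  4 * a * b * c = 1 -> b * (m2 * m3 - 1) = 1 -> c * (1 - m3 * m4) = 1 ->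
  X + W = 1 -> m3 ^ 4 = m2 ^ 4 * X + m4 ^ 4 * W -> X * W = d ^ 4 -> d * (m2 + m4) = m3 ->
  16 * a ^ 2 - 12 * a + 1 = 0 /\ 4 * a ^ 2 * c ^ 2 = a + c + 2 * a * c.
Proof.
  intros Ha Hb Hc H2 H3 H4 E3 E4 E2 Eabc E23 E34 EXW EJ Ed ED.
  assert (Eb : m2 * m3 = 1 + 4 * a * c).
  { apply (Rmult_eq_reg_l b); [|lra]. lra. }
  assert (Rel : 4 * a ^ 2 * c ^ 2 = a + c + 2 * a * c).
  { assert (Q : m2 ^ 2 * m3 ^ 2 = (1 + 4 * a * c) ^ 2) by (rewrite <- Eb; ring).
    rewrite E2, E3 in Q; lra. }
  assert (E24 : a * (m2 * m4) = 1 - a).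
  { assert (Hca : 0 < c * (1 + 4 * a)) by (apply Rmult_lt_0_compat; lra).
    apply (Rmult_eq_reg_l (c * (1 + 4 * a))); [|lra].
    transitivity (a * (m2 * m3) * (c * (m3 * m4))); [rewrite <- E3; ring|].
    replace (c * (m3 * m4)) with (c - 1) by lra; rewrite Eb; lra. }
  (* Only the degree 5 relations enter here; comparison with the hypothesis on [d] then forces d =
     a. *)
  assert (Esum : (a * (m2 + m4)) ^ 2 = m3 ^ 2).
  { apply (Rmult_eq_reg_l c); [|lra].
    transitivity (c * a ^ 2 * (m2 ^ 2 + m4 ^ 2) + 2 * c * a * (a * (m2 * m4))); [ring|].
    rewrite E24, E2, E3, E4.
    assert (4 * a ^ 2 * b * c = a) by (rewrite <- (Rmult_1_r a) at 2; rewrite <- Eabc; ring).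
    lra. }
  assert (Esum' : a * (m2 + m4) = m3).
  { assert (0 < a * (m2 + m4)) by (apply Rmult_lt_0_compat; lra).
    apply Rsqr_inj; [lra|lra|]. unfold Rsqr; lra. }
  assert (Eda : d = a).
  { apply (Rmult_eq_reg_r (m2 + m4)); [|lra]. now rewrite ED. }
  subst d; split; [|exact Rel].
  (* Both c - b and b c are rational in a, by [Ee] and [Eabc]. Solving the two quartic relations for
     [X] and [W] makes X W (c + b)^2 (1 + 2 e)^2 a polynomial in these, so X W = a^4 becomes an
     equation in a alone. *)
  set (e := c - b).
  assert (Ee : 4 * a ^ 2 * e = 2 * a + 1).
  { apply (Rmult_eq_reg_l c); [|lra]. unfold e.
    assert (4 * a ^ 2 * b * c = a) by (rewrite <- (Rmult_1_r a) at 2; rewrite <- Eabc; ring).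
    lra. }
  assert (EX : X * ((c + b) * (1 + 2 * e)) = (a + b) * (1 + 2 * a - 2 * b)).
  { replace (m3 ^ 4) with ((m3 ^ 2) ^ 2) in EJ by ring.
    replace (m2 ^ 4) with ((m2 ^ 2) ^ 2) in EJ by ring.
    replace (m4 ^ 4) with ((m4 ^ 2) ^ 2) in EJ by ring.
    rewrite E2, E3, E4 in EJ; replace W with (1 - X) in EJ by lra; unfold e; lra. }
  assert (EW : W * ((c + b) * (1 + 2 * e)) = (c - a) * (1 + 2 * c + 2 * a)).
  { replace W with (1 - X) by lra; rewrite Rmult_minus_distr_r, EX; unfold e; ring. }
  assert (EP1 : 4 * a * ((a + b) * (c - a)) = 2 + 2 * a - 4 * a ^ 3).
  { transitivity (4 * a ^ 2 * e - 4 * a ^ 3 + 4 * a * b * c); [unfold e; ring|].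
    rewrite Ee, Eabc; ring. }
  assert (EP2 : 2 * a ^ 2 * ((1 + 2 * a - 2 * b) * (1 + 2 * c + 2 * a)) =
    2 * a ^ 2 * (1 + 2 * a) ^ 2 + (1 + 2 * a) ^ 2 - 2 * a).
  { transitivity (2 * a ^ 2 * (1 + 2 * a) ^ 2 + (1 + 2 * a) * (4 * a ^ 2 * e) -
      2 * a * (4 * a * b * c)); [unfold e; ring|].
    rewrite Ee, Eabc; ring. }
  assert (EQ : 16 * a ^ 4 * (c + b) ^ 2 = (2 * a + 1) ^ 2 + 16 * a ^ 3).
  { transitivity ((4 * a ^ 2 * e) ^ 2 + 16 * a ^ 3 * (4 * a * b * c)); [unfold e; ring|].
    rewrite Ee, Eabc; ring. }
  assert (ES : 2 * a ^ 2 * (1 + 2 * e) = 2 * a ^ 2 + 2 * a + 1) by lra.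
  assert (Main : 8 * a * (2 + 2 * a - 4 * a ^ 3) *
      (2 * a ^ 2 * (1 + 2 * a) ^ 2 + (1 + 2 * a) ^ 2 - 2 * a) =
      ((2 * a + 1) ^ 2 + 16 * a ^ 3) * (2 * a ^ 2 + 2 * a + 1) ^ 2).
  { rewrite <- EP1, <- EP2, <- EQ, <- ES.
    transitivity (64 * a ^ 4 * ((X * ((c + b) * (1 + 2 * e))) * (W * ((c + b) * (1 + 2 * e))))).
    - rewrite EX, EW; ring.
    - transitivity (64 * a ^ 4 * (X * W) * ((c + b) * (1 + 2 * e)) ^ 2); [ring|].
      rewrite Ed; ring. }
  (* The difference of the two sides of [Main], factored; the first two factors are positive. *)
  assert (Fac : (2 * a ^ 2 + 2 * a + 1) ^ 2 * (4 * a ^ 2 + 1) * (16 * a ^ 2 - 12 * a + 1) = 0) by lra.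
  assert (Ha2 : 0 < a ^ 2) by now apply pow_lt.
  assert (Hn : 0 < (2 * a ^ 2 + 2 * a + 1) ^ 2 * (4 * a ^ 2 + 1)).
  { apply Rmult_lt_0_compat; [apply pow_lt|]; lra. }
  destruct (Rmult_integral _ _ Fac); lra.
Qed.

Lemma theta3_upper t : 0 < t -> Th false 0 t <= (1 + exp (- t)) / (1 - exp (- t)).
Proof.
  intros Ht; pose proof (exp_neg_bounds t Ht) as Hx.
  apply (has_sum_le_bound (theta_term false 0 t)); [|now apply Th_has_sum].
  intros B NB.
  apply Rle_trans with (lsum (fun n => Rabs (theta_term false 0 t n)) B).
  - apply lsum_le; intros n; apply Rle_abs.
  - rewrite <- (Rmult_1_l (_ / _)).
    apply (abs_bounded_geom (theta_term false 0 t) 1 (exp (- t)) Hx ltac:(lra)); [|exact NB].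
    intros n; rewrite theta_term_abs, Rmult_1_l, exp_pow; apply exp_le_compat.
    rewrite Rplus_0_r, <- (pow2_abs (IZR n)), <- INR_Zabs_nat.
    pose proof (INR_le_sqr (Z.abs_nat n)); nra.
Qed.

Lemma sqrt_sqr_eq x : 0 <= x -> sqrt x ^ 2 = x.
Proof. intros Hx; rewrite <- Rsqr_pow2; now apply Rsqr_sqrt. Qed.

(* The hypothesis says that the inversion t -> PI^2 / t sends t to 5 t / 3, so the cubic
   identity becomes a relation between the theta values at t and at 5 t. *)
Lemma theta_inverted_cubic t : 0 < t -> 3 * PI ^ 2 = 5 * t ^ 2 ->
  Th false 0 t * Th false 0 (5 * t) =
  Th false (1 / 2) t * Th true 0 (5 * t) + Th true 0 t * Th false (1 / 2) (5 * t).
Proof.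
  intros Ht E.
  set (u := 5 * t / 3).
  assert (Hu : 0 < u) by (unfold u; lra).
  assert (Eu : PI ^ 2 = u * t) by (unfold u; simpl in E |- *; lra).
  pose proof (theta_inversion_ratio (/ t) (Rinv_0_lt_compat _ Ht)) as I1.
  pose proof (theta_inversion_ratio (/ u) (Rinv_0_lt_compat _ Hu)) as I2.
  rewrite Eu in I1, I2.
  replace (1 / / t) with t in I1 by (field; lra); replace (u * t * / t) with u in I1 by (field; lra).
  replace (1 / / u) with u in I2 by (field; lra); replace (u * t * / u) with t in I2 by (field; lra).
  pose proof (Th_cubic u Hu) as D; replace (3 * u) with (5 * t) in D by (unfold u; field).
  pose proof (Th_false_pos 0 u Hu) as Pu.
  apply (Rmult_eq_reg_l (Th false 0 u)); [|lra].
  transitivity (Th false 0 t * (Th false 0 u * Th false 0 (5 * t))); [ring|].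
  rewrite D.
  transitivity ((Th true 0 u * Th false 0 t) * Th true 0 (5 * t) +
    (Th false 0 t * Th false (1 / 2) u) * Th false (1 / 2) (5 * t)); [ring|].
  rewrite I2, <- I1; ring.
Qed.

Lemma theta_evaluation t : 0 < t -> 3 * PI ^ 2 = 5 * t ^ 2 ->
  (Th false (1 / 2) t / Th false (1 / 2) (5 * t)) ^ 4 *
  (Th false 0 t / Th false 0 (5 * t)) * (Th true 0 t / Th true 0 (5 * t)) =
  4225 + 1885 * sqrt 5 + 4875 * sqrt 3 / 2 + 2175 * (sqrt 3 * sqrt 5) / 2.
Proof.
  intros Ht E.
  pose proof (quintic_parameters t Ht) as Q; cbv zeta in Q.
  assert (P2 : 0 < Th false (1 / 2) (5 * t)) by (apply Th_false_pos; lra).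
  assert (P3 : 0 < Th false 0 (5 * t)) by (apply Th_false_pos; lra).
  assert (P4 : 0 < Th true 0 (5 * t)) by (apply Th_true_pos; lra).
  pose proof (Th_false_pos (1 / 2) t Ht) as Q2; pose proof (Th_false_pos 0 t Ht) as Q3.
  pose proof (Th_true_pos 0 t Ht ltac:(lra)) as Q4.
  pose proof (jacobi_quartic t Ht) as J; pose proof (jacobi_quartic (5 * t) ltac:(lra)) as J'.
  pose proof (theta_inverted_cubic t Ht E) as D.
  assert (N1 : 1 <= Th false 0 (5 * t)).
  { eapply Rle_trans; [|apply Th_false_ge_term; lra].
    replace (- (5 * t * 0 ^ 2)) with 0 by ring; rewrite exp_0; lra. }
  (* Selects between the roots (3 - sqrt 5) / 8 and (3 + sqrt 5) / 8 for [a]: the larger one exceeds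
     0.65, whereas 1 + 4 a < 3.6 forces a < 0.65. The estimate 2.3 < t follows from PI > 3. *)
  assert (N2 : Th false 0 t ^ 2 < 36 / 10).
  { assert (T1 : 23 / 10 < t).
    { pose proof PI2_3_2; apply Rnot_le_lt; intros T; assert (9 < PI ^ 2) by nra; nra. }
    assert (Hx : exp (- t) <= / (33 / 10)).
    { rewrite exp_Ropp; apply Rinv_le_contravar; [lra|].
      pose proof (exp_ineq1_le t); lra. }
    pose proof (theta3_upper t Ht) as U; pose proof (exp_neg_bounds t Ht) as Hx'.
    assert (U' : (1 + exp (- t)) / (1 - exp (- t)) <= 43 / 23).
    { apply Rcomplements.Rle_div_l; lra. }
    nra. }
  set (y2 := Th false (1 / 2) (5 * t)) in *; set (y3 := Th false 0 (5 * t)) in *.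
  set (y4 := Th true 0 (5 * t)) in *; set (x2 := Th false (1 / 2) t) in *.
  set (x3 := Th false 0 t) in *; set (x4 := Th true 0 t) in *.
  destruct Q as [a [b [c [Ha [Hb [Hc [E3 [E4 [E2 [Eabc [E23 E34]]]]]]]]]]].
  assert (M2 : 0 < x2 / y2) by now apply Rdiv_lt_0_compat.
  assert (M3 : 0 < x3 / y3) by now apply Rdiv_lt_0_compat.
  assert (M4 : 0 < x4 / y4) by now apply Rdiv_lt_0_compat.
  destruct (quintic_parameter_eq a b c (x2 / y2) (x3 / y3) (x4 / y4) (y2 ^ 4 / y3 ^ 4) (y4 ^ 4 / y3 ^ 4)
    (y2 * y4 / y3 ^ 2)) as [Ra Rc]; try assumption.
  { transitivity ((y2 ^ 4 + y4 ^ 4) / y3 ^ 4); [field; lra|]. rewrite <- J'; field; lra. }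
  { transitivity (x3 ^ 4 / y3 ^ 4); [field; lra|]. rewrite J; field; lra. }
  { field; lra. }
  { transitivity ((x2 * y4 + x4 * y2) / y3 ^ 2); [field; lra|]. rewrite <- D; field; lra. }
  set (s := sqrt 5); set (r := sqrt 3).
  assert (Hs : s ^ 2 = 5) by (apply sqrt_sqr_eq; lra).
  assert (Hr : r ^ 2 = 3) by (apply sqrt_sqr_eq; lra).
  assert (Ps : 0 <= s) by apply sqrt_pos.
  assert (Pr : 0 <= r) by apply sqrt_pos.
  assert (Ls : 22 / 10 < s < 23 / 10) by nra.
  assert (La : a < 65 / 100).
  { assert (B1 : (x3 / y3) ^ 2 < 36 / 10); [|lra].
    rewrite Rdiv_pow_2 by lra; apply Rcomplements.Rlt_div_l; nra. }
  assert (Ea : a = (3 - s) / 8).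
  { assert (Z : (a - (3 - s) / 8) * (a - (3 + s) / 8) = 0).
    { replace ((a - (3 - s) / 8) * (a - (3 + s) / 8)) with
        ((16 * a ^ 2 - 12 * a + 1) / 16 + (5 - s ^ 2) / 64) by field.
      rewrite Ra, Hs; field. }
    destruct (Rmult_integral _ _ Z); lra. }
  (* The positive root of 4 a^2 c^2 - (1 + 2 a) c - a = 0 at a = (3 - sqrt 5) / 8. *)
  set (c0 := (17 + 7 * s) / 2 + r * (5 + 2 * s)).
  assert (Hc0 : 0 < c0) by (unfold c0; nra).
  assert (Rc0 : 4 * a ^ 2 * c0 ^ 2 = a + c0 + 2 * a * c0).
  { rewrite Ea; unfold c0; field [Hs Hr]. }
  assert (Ec : c = c0).
  { assert (Z : (c - c0) * (4 * a ^ 2 * c * c0 + a) = 0).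
    { transitivity (c0 * (4 * a ^ 2 * c ^ 2 - (a + c + 2 * a * c))
        - c * (4 * a ^ 2 * c0 ^ 2 - (a + c0 + 2 * a * c0))); [ring|].
      rewrite Rc, Rc0; ring. }
    assert (0 < 4 * a ^ 2 * c * c0).
    { repeat apply Rmult_lt_0_compat; try lra; now apply pow_lt. }
    destruct (Rmult_integral _ _ Z); lra. }
  transitivity (((x2 / y2) ^ 2) ^ 2 * ((x3 / y3) * (x4 / y4))); [ring|].
  rewrite E2; apply (Rmult_eq_reg_l c); [|lra].
  transitivity ((1 + 4 * c) ^ 2 * (c - 1)).
  - replace (c - 1) with (c * (x3 / y3 * (x4 / y4))) by lra; ring.
  - rewrite Ec; unfold c0; field [Hs Hr].
Qed.

Lemma sqrt_root_eq y A : 0 < y -> 0 < A -> 1 / y - y = 2 * A -> y = sqrt (A ^ 2 + 1) - A.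
Proof.
  intros Hy HA H.
  assert (E : A ^ 2 + 1 = (y + A) ^ 2).
  { assert (Q : 1 - y * y = 2 * A * y) by (rewrite <- H; field; lra); lra. }
  rewrite E, sqrt_pow2; lra.
Qed.

Theorem theorem5 :
  let a := 2118 + 1885 * sqrt 5 / 2 + 4875 * sqrt 3 / 4 + 2175 * sqrt 15 / 4 in
  RogersRamanujan (exp (- PI * sqrt (48 / 5))) ^ 5 = sqrt (a ^ 2 + 1) - a.
Proof.
  intros a; pose proof PI_RGT_0 as HP.
  set (t := PI * sqrt (48 / 5) / 4).
  assert (Hq : 0 < sqrt (48 / 5)) by (apply sqrt_lt_R0; lra).
  assert (Ht : 0 < t) by (unfold t; apply Rdiv_lt_0_compat; [apply Rmult_lt_0_compat|]; lra).
  assert (Et : 3 * PI ^ 2 = 5 * t ^ 2).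
  { unfold t; pose proof (sqrt_sqr_eq (48 / 5) ltac:(lra)) as Q.
    transitivity (5 * (PI ^ 2 * sqrt (48 / 5) ^ 2 / 16)); [rewrite Q|]; field. }
  replace (- PI * sqrt (48 / 5)) with (- (4 * t)) by (unfold t; field).
  rewrite RogersRamanujan_theta by lra; replace (5 / 2 * (4 * t)) with (10 * t) by field.
  pose proof (rr_quintic t Ht) as Q; cbv zeta in Q; rewrite (theta_evaluation t Ht Et) in Q.
  assert (Hu : 0 < Th true (3 / 10) (10 * t) / Th true (1 / 10) (10 * t)).
  { apply Rdiv_lt_0_compat; apply Th_true_pos; lra. }
  apply sqrt_root_eq; [now apply pow_lt| |].
  - unfold a; pose proof (sqrt_pos 5); pose proof (sqrt_pos 3); pose proof (sqrt_pos 15); lra.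
  (* The constant 2118 is half of 11 + 4225. *)
  - unfold a; replace 15 with (3 * 5) by ring; rewrite sqrt_mult by lra; lra.
Qed.
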